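(* Consider the system $x_{t+1}=Ax_t+Bu_t$, $y_t=Cx_t+Du_t$, the data $(u^d,y^d)$, the cost functions $L_t(u,y)=f^u_t(u)+f^y_t(y)$ with minimizers $\eta_t,\theta_t$, and Algorithm 1, all as specified in the context, and let Assumptions 1-5 listed in the context be satisfied. Let the step sizes satisfy $0<\gamma_u\le \frac{2}{l_u+\alpha_u}$ and $0<\gamma_y\le\frac{2}{l_y+\alpha_y}$. Let $(u_t,y_t)_{t\ge 0}$ be the closed-loop input-output sequence obtained by applying Algorithm 1 to the system. Then there exist finite constants $C_\mu,C_u,C_y$ independent of $T$ such that, for every horizon $T$, the dynamic regret $$\mathcal{R}=\sum_{t=0}^T \big(L_t(u_t,y_t)-L_t(u^*_t,y^*_t)\big)$$ satisfies $$\mathcal{R}\le C_\mu+C_u\sum_{t=0}^T\|\eta_t-\eta_{t-1}\|+C_y\sum_{t=0}^T\|\theta_t-\theta_{t-1}\|.$$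
   Context: **System and data.** The system is $x_{t+1}=Ax_t+Bu_t$, $y_t=Cx_t+Du_t$ with $x_t\in\mathbb{R}^n$, $u_t\in\mathbb{R}^m$, $y_t\in\mathbb{R}^p$, $(A,B)$ controllable, $(A,C)$ observable, and given initial state $x_0$. A finite input-output sequence is a trajectory of the system if it satisfies these equations for some initial state. The data $\{u^d_k,y^d_k\}_{k=0}^{N-1}$ is a trajectory of the system. A pair $(u^s,y^s)$ is an equilibrium if the constant sequence $(u_k,y_k)=(u^s,y^s)$, $k=0,\dots,n$, is a trajectory of the system. **Notation.** For a sequence $z=\{z_k\}_{k=1}^N$ of vectors, $H_L(z)$ is the block Hankel matrix with $L$ block rows and $N-L+1$ columns whose $(i,j)$ block is $z_{i+j-1}$ (indices are shifted for sequences indexed from 0). For such a block matrix $M$, $M^{a}$ is its $a$-th block row and $M^{a:b}$ consists of block rows $a,\dots,b$. A signal $u$ with values in $\mathbb{R}^m$ is persistently exciting of order $L$ if $\operatorname{rank} H_L(u)=mL$. $z_{[a:b]}$ is the stacked vector of $z_a,\dots,z_b$; $\sigma z$ is the stacked vector $z$ with its first block removed; $1_k$, $0_k\in\mathbb{R}^k$ are the all-ones and zero vectors, $I_k$ the identity, $I$ an identity of appropriate size, $\otimes$ the Kronecker product, $M^\dagger$ the Moore-Penrose pseudoinverse, $\|\cdot\|$ the Euclidean norm. **Costs.** $L_t:\mathbb{R}^m\times\mathbb{R}^p\to\mathbb{R}$, $t=0,1,2,\dots$, is revealed only after $u_t$ has been applied. For each $T$, $(u^*_t,y^*_t)_{t=0}^T$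 is the optimal input-output sequence in hindsight, i.e. a solution of $\min_{u_0,\dots,u_T}\sum_{t=0}^T L_t(u_t,y_t)$ subject to the system dynamics with initial state $x_0$. Let $\eta_t=\arg\min_u f_t^u(u)$ and $\theta_t=\arg\min_y f^y_t(y)$. **Assumptions.** 1. For every $y\in\mathbb{R}^p$ there is $u\in\mathbb{R}^m$ such that $(u,y)$ is an equilibrium. 2. $L_t(u,y)=f^u_t(u)+f^y_t(y)$ where, for $\xi\in\{u,y\}$ and all $t$, $f^\xi_t$ is $\alpha_\xi$-strongly convex ($\alpha_\xi>0$) and $l_\xi$-smooth (differentiable with $l_\xi$-Lipschitz gradient), with constants independent of $t$. Moreover there are bounded sets $\mathcal{U}\subset\mathbb{R}^m$, $\mathcal{Y}\subset\mathbb{R}^p$ with $u_t,\eta_t\in\mathcal{U}$ and $y_t,\theta_t\in\mathcal{Y}$ for all $t\ge 0$ (where $(u_t,y_t)$ is the closed loop), on which all $f^u_t$, respectively all $f^y_t$, are Lipschitz continuous with constants $L_u$, respectively $L_y$, independent of $t$. 3. $(\eta_t,\theta_t)$ is an equilibrium of the system for all $t\geq 0$. 4. $u^d$ is persistently exciting of order $3n+\mu+1$. 5. The prediction horizon $\mu$ satisfies $\mu\ge\mu^*$, where $\mu^*$ is the controllability index of the system (the smallest $k$ such that $[B\ AB\ \cdots\ A^{k-1}B]$ has rank $n$). **Matrices.** Let $\tilde\mu=n+\mu+1$, $U=H_{2n+\mu+1}(u^d)$, $Y=H_{2n+\mu+1}(y^d)$, $$H_\alpha=\begin{bmatrix} U^{1:n}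 \\ U^{n+1:\tilde\mu+n} \\ Y^{1:n} \end{bmatrix},\qquad H_\beta=\begin{bmatrix} U^{1:n} \\ U^{\tilde\mu:\tilde\mu+n} \\ Y^{1:n} \\ Y^{\tilde\mu:\tilde\mu+n-1} \end{bmatrix}.$$ Let $Q$ be a fixed weighting matrix with $N-2n-\mu$ columns. Let $H_{n+1}=\begin{bmatrix} H_{n+1}(u^d) \\ H_{n+1}(y^d) \end{bmatrix}$ and $$\begin{bmatrix} S_u & S_y \end{bmatrix}=\left(H_{n+1}H_{n+1}^\dagger-I_{(m+p)(n+1)}\right)\begin{bmatrix} 1_{n+1}\otimes I_m & 0 \\ 0 & 1_{n+1}\otimes I_p \end{bmatrix},$$ with $S_u$ the first $m$ columns and $S_y$ the last $p$ columns. **Algorithm 1.** Given step sizes $\gamma_u,\gamma_y$, data $(u^d,y^d)$, and initialization $v_0\in\mathbb{R}^m$, $\hat u_{-1}\in\mathbb{R}^{m(\mu+1)}$, at each time $t\ge 0$: (a) $v_t=v_{t-1}-\gamma_u\nabla f^u_{t-1}(v_{t-1})$ (for $t\ge1$; $v_0$ is given). (b) Choose $\omega_t,\alpha_t$ such that $$H_\alpha\omega_t=\begin{bmatrix} 0_{mn} \\ 1_{n+\mu+1}\otimes v_t \\ 0_{pn} \end{bmatrix},\qquad H_\alpha\alpha_t=\begin{bmatrix} u_{[t-n:t-1]} \\ \sigma\hat u_{t-1} \\ 1_{n+1}\otimes(u^s_{t-1}-v_{t-1}) \\ y_{[t-n:t-1]} \end{bmatrix},$$ for example by applying $H_\alpha^\dagger$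 to the right-hand sides. (c) $\hat y^\mu_t=Y^{n+\mu+1}(\alpha_t+\omega_t)$. (d) $y^s_t=\hat y^\mu_t-\gamma_y\nabla f^y_{t-1}(\hat y^\mu_t)$ (for $t\ge 1$). (e) $u^s_t=(I_m-S_u^\dagger S_u)v_t-S_u^\dagger S_y y^s_t$. (f) $\beta_t=\arg\min_\beta\|Q\beta\|$ subject to $H_\beta\beta=g_t$, where $$g_t=\begin{bmatrix} 0_{mn} \\ 1_{n+1}\otimes u^s_t-U^{\tilde\mu:\tilde\mu+n}(\alpha_t+\omega_t) \\ 0_{pn} \\ 1_n\otimes y^s_t-Y^{\tilde\mu:\tilde\mu+n-1}(\alpha_t+\omega_t) \end{bmatrix},$$ solved by the weighted pseudoinverse formula $\beta_t=\left(I-\left(Q(I-H_\beta^\dagger H_\beta)\right)^\dagger Q\right)H_\beta^\dagger g_t$. (g) $\hat u_t=\begin{bmatrix} \sigma\hat u_{t-1} \\ {u^s_{t-1}-v_{t-1}} \end{bmatrix}+U^{n+1:n+\mu+1}\beta_t\in\mathbb{R}^{m(\mu+1)}$. (h) $u_t=\hat u_{t,1}+v_t$, where $\hat u_{t,1}\in\mathbb{R}^m$ is the first block of $\hat u_t$. Then $u_t$ is applied to the system, $y_t$ is measured and $L_t$ is revealed. **Initial-time conventions.** The past values $u_{-n},\dots,u_{-1}$, $y_{-n},\dots,y_{-1}$ are the inputs and outputs of the system on times $-n,\dots,-1$ (a trajectory ending in the state $x_0$ at time $0$). Moreover $\eta_{-1}=v_{-1}=v_0$, $u^s_{-1}=v_{-1}$,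 and $y^s_0=\hat y^\mu_0=\theta_{-1}$ (that is, $y^s_0$ and $\theta_{-1}$ are defined to equal the prediction $\hat y_0^\mu$). The cost sequence $(L_t)_{t\ge0}$, the system, the data and the initialization are fixed; ''independent of $T$'' means the constants work for all horizons $T$ simultaneously. *)

(* Defs.v *)
From HB Require Import structures.
From mathcomp Require Import all_boot all_order all_algebra.
From mathcomp Require Import mxtens.
From mathcomp Require Import all_classical all_reals all_analysis.

Set Implicit Arguments.
Unset Strict Implicit.
Unset Printing Implicit Defensive.

Import Order.TTheory GRing.Theory Num.Theory.
Import numFieldNormedType.Exports.
Local Open Scope classical_set_scope.
Local Open Scope ring_scope.

(* A stack of L blocks with m rows each has type 'M_(L * m, c); its rows are
   indexed through mxtens_index, so that block i, row r is row i * m + r, as in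
   the Kronecker product of mxtens. Blocks are numbered from 0. *)
Section Blocks.
Variable R : realType.

Definition blockcol (m c L : nat) (F : nat -> 'M[R]_(m, c)) : 'M[R]_(L * m, c) :=
  \matrix_(k, j) F (mxtens_unindex k).1 (mxtens_unindex k).2 j.

(* Returns 0 when i is not smaller than L. *)
Definition brow (m c L : nat) (i : nat) (M : 'M[R]_(L * m, c)) : 'M[R]_(m, c) :=
  \matrix_(r, j)
    if insub i is Some i' then M (mxtens_index (i', r)) j else 0.

(* Block rows a, ..., a + l - 1 counted from 0. *)
Definition brows (m c L : nat) (a l : nat) (M : 'M[R]_(L * m, c)) :
    'M[R]_(l * m, c) :=
  blockcol l (fun i => brow (a + i) M).

Definition bcat (m c k l : nat) (M : 'M[R]_(k * m, c)) (M' : 'M[R]_(l * m, c)) :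
    'M[R]_((k + l) * m, c) :=
  castmx (esym (mulnDl k l m), erefl c) (col_mx M M').

(* 1_k (x) M *)
Definition ones_tens (m c : nat) (k : nat) (M : 'M[R]_(m, c)) : 'M[R]_(k * m, c) :=
  castmx (erefl (k * m)%N, mul1n c) (tensmx (const_mx 1 : 'cV[R]_k) M).

Definition window (m : nat) (z : int -> 'cV[R]_m) (a : int) (l : nat) :
    'cV[R]_(l * m) :=
  blockcol l (fun i => z (a + i%:Z)).

(* Number N - L + 1 of columns of H_L(z) for z of length N; it is 0 if N < L. *)
Definition ncols (N L : nat) : nat := (N.+1 - L)%N.

(* Only z 0, ..., z (N - 1) occur in the matrix. *)
Definition hankel (m N L : nat) (z : nat -> 'cV[R]_m) :
    'M[R]_(L * m, ncols N L) :=
  blockcol L (fun i => \matrix_(r, j) z (i + j)%N r 0).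

Definition persistently_exciting (m N L : nat) (z : nat -> 'cV[R]_m) : Prop :=
  \rank (hankel N L z) = (m * L)%N.

Definition is_pinv (a b : nat) (M : 'M[R]_(a, b)) (X : 'M[R]_(b, a)) : Prop :=
  [/\ M *m X *m M = M, X *m M *m X = X,
      (M *m X)^T = M *m X & (X *m M)^T = X *m M].

(* Moore-Penrose pseudoinverse: the matrix X such that is_pinv M X. *)
Definition pinv (a b : nat) (M : 'M[R]_(a, b)) : 'M[R]_(b, a) :=
  xget 0 [set X | is_pinv M X].

End Blocks.

Section Functions.
Variables (R : realType) (k : nat).
Implicit Types (f : 'cV[R]_k -> R) (x y : 'cV[R]_k).

(* The library norm `|x| on matrices is the maximum norm. *)
Definition enorm x : R := Num.sqrt (\sum_i x i 0 ^+ 2).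

Definition grad f x : 'cV[R]_k := \col_i 'D_(delta_mx i 0) f x.

Definition strongly_convex (a : R) f : Prop :=
  forall x y (s : R), 0 <= s <= 1 ->
    f (s *: x + (1 - s) *: y) <=
      s * f x + (1 - s) * f y - a / 2 * s * (1 - s) * enorm (x - y) ^+ 2.

Definition smooth (l : R) f : Prop :=
  (forall x, differentiable f x) /\
  (forall x y, enorm (grad f x - grad f y) <= l * enorm (x - y)).

Definition is_argmin f x : Prop := forall x', f x <= f x'.

(* A bounded set contains the signals z and e at all nonnegative times, and on
   it all f t are Lipschitz with a common constant. *)
Definition lipschitz_on_bounded (f : nat -> 'cV[R]_k -> R)
    (z e : int -> 'cV[R]_k) : Prop :=
  exists (X : set 'cV[R]_k) (K : R),
    [/\ bounded_set X,
        forall t : nat, X (z t) /\ X (e t) &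
        forall (t : nat) x y, X x -> X y ->
          `|f t x - f t y| <= K * enorm (x - y)].

End Functions.

Record lti (R : realType) (n m p : nat) := Lti {
  sysA : 'M[R]_n;
  sysB : 'M[R]_(n, m);
  sysC : 'M[R]_(p, n);
  sysD : 'M[R]_(p, m) }.

Section Systems.
Variables (R : realType) (n m p : nat) (S : lti R n m p).

Definition ctrb_mx (k : nat) := \mxrow_(i < k) (sysA S ^+ i *m sysB S).

Definition controllable : Prop := \rank (ctrb_mx n) = n.

Definition observable : Prop :=
  \rank (\mxcol_(i < n) (sysC S *m sysA S ^+ i)) = n.

Definition is_ctrb_index (k : nat) : Prop :=
  \rank (ctrb_mx k) = n /\ forall j, \rank (ctrb_mx j) = n -> (k <= j)%N.

Definition sys_eq (x x' : 'cV[R]_n) (u : 'cV[R]_m) (y : 'cV[R]_p) : Prop :=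
  x' = sysA S *m x + sysB S *m u /\ y = sysC S *m x + sysD S *m u.

(* Only the first L elements of u and y are constrained. *)
Definition traj_from (x0 : 'cV[R]_n) (L : nat)
    (u : nat -> 'cV[R]_m) (y : nat -> 'cV[R]_p) : Prop :=
  exists x : nat -> 'cV[R]_n, x 0%N = x0 /\
    forall k, (k < L)%N -> sys_eq (x k) (x k.+1) (u k) (y k).

Definition is_traj (L : nat) (u : nat -> 'cV[R]_m) (y : nat -> 'cV[R]_p) : Prop :=
  exists x0, traj_from x0 L u y.

Definition equilibrium (us : 'cV[R]_m) (ys : 'cV[R]_p) : Prop :=
  is_traj n.+1 (fun=> us) (fun=> ys).

(* The signals satisfy the system equations at all times >= -n and the state at
   time 0 is x0. *)
Definition system_response (x0 : 'cV[R]_n)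
    (u : int -> 'cV[R]_m) (y : int -> 'cV[R]_p) : Prop :=
  exists x : int -> 'cV[R]_n, x 0 = x0 /\
    forall k : int, - n%:Z <= k -> sys_eq (x k) (x (k + 1)) (u k) (y k).

Definition hindsight_optimal (x0 : 'cV[R]_n)
    (L : nat -> 'cV[R]_m -> 'cV[R]_p -> R) (T : nat)
    (u : nat -> 'cV[R]_m) (y : nat -> 'cV[R]_p) : Prop :=
  traj_from x0 T.+1 u y /\
  forall u' y', traj_from x0 T.+1 u' y' ->
    \sum_(0 <= t < T.+1) L t (u t) (y t) <=
    \sum_(0 <= t < T.+1) L t (u' t) (y' t).

End Systems.

(* Block rows a, ..., b counted from 1 are brows a.-1 (b - a + 1); in particular
   rows n + 1, ..., 2 n + mu + 1 are brows n (mu + n.+1), and rows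
   n + mu + 1, ..., 2 n + mu + 1 are brows (n + mu) n.+1. *)
Section DataMatrices.
Variables (R : realType) (n m p N mu : nat).
Variables (ud : nat -> 'cV[R]_m) (yd : nat -> 'cV[R]_p).

Definition dataU := hankel N (2 * n + mu).+1 ud.
Definition dataY := hankel N (2 * n + mu).+1 yd.

Definition Halpha :=
  col_mx (col_mx (brows 0 n dataU) (brows n (mu + n.+1) dataU))
         (brows 0 n dataY).

Definition Hbeta :=
  col_mx (col_mx (brows 0 n dataU) (brows (n + mu) n.+1 dataU))
         (col_mx (brows 0 n dataY) (brows (n + mu) n dataY)).

Definition Hequil := col_mx (hankel N n.+1 ud) (hankel N n.+1 yd).

Definition equil_mx : 'M[R]_(n.+1 * m + n.+1 * p, m + p) :=
  (Hequil *m pinv Hequil - 1%:M) *m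
  block_mx (ones_tens n.+1 (1%:M : 'M[R]_m)) 0
           0 (ones_tens n.+1 (1%:M : 'M[R]_p)).

Definition Su := lsubmx equil_mx.
Definition Sy := rsubmx equil_mx.

End DataMatrices.

(* Weighted pseudoinverse formula for the minimization of the Euclidean norm of
   Q *m b subject to H *m b = g. *)
Definition weighted_sol (R : realType) (q a c : nat) (Q : 'M[R]_(q, c))
    (H : 'M[R]_(a, c)) (g : 'cV[R]_a) : 'cV[R]_c :=
  (1%:M - pinv (Q *m (1%:M - pinv H *m H)) *m Q) *m (pinv H *m g).

(* Internal signals of the algorithm; those that are needed at time -1 are
   indexed by int. *)
Record iterates (R : realType) (m p mu c : nat) := Iterates {
  it_v : int -> 'cV[R]_m;
  it_us : int -> 'cV[R]_m;
  it_uhat : int -> 'cV[R]_((mu + 1) * m);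
  it_ys : nat -> 'cV[R]_p;
  it_yhat : nat -> 'cV[R]_p;
  it_omega : nat -> 'cV[R]_c;
  it_alpha : nat -> 'cV[R]_c;
  it_beta : nat -> 'cV[R]_c }.

Section Algorithm.
Variables (R : realType) (n m p N mu q : nat).
Variables (ud : nat -> 'cV[R]_m) (yd : nat -> 'cV[R]_p).
Variable Q : 'M[R]_(q, ncols N (2 * n + mu).+1).
Variables (gu gy : R) (fu : nat -> 'cV[R]_m -> R) (fy : nat -> 'cV[R]_p -> R).
Variables (v0 : 'cV[R]_m) (uhat0 : 'cV[R]_((mu + 1) * m)).
Variable I : iterates R m p mu (ncols N (2 * n + mu).+1).
Variables (u : int -> 'cV[R]_m) (y : int -> 'cV[R]_p).

Local Notation v := (it_v I).
Local Notation us := (it_us I).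
Local Notation uhat := (it_uhat I).
Local Notation ys := (it_ys I).
Local Notation yhat := (it_yhat I).
Local Notation omega := (it_omega I).
Local Notation alpha := (it_alpha I).
Local Notation beta := (it_beta I).
Local Notation U := (dataU n N mu ud).
Local Notation Y := (dataY n N mu yd).
Local Notation Ha := (Halpha n N mu ud yd).
Local Notation Hb := (Hbeta n N mu ud yd).
Local Notation SU := (Su n N ud yd).
Local Notation SY := (Sy n N ud yd).

Definition rhs_omega (t : nat) :=
  col_mx (col_mx (0 : 'cV[R]_(n * m)) (ones_tens (mu + n.+1) (v t)))
         (0 : 'cV[R]_(n * p)).

(* brows 1 mu z is the stacked vector z without its first block. *)
Definition rhs_alpha (t : nat) :=
  col_mx (col_mx (window u (t%:Z - n%:Z) n)
                 (bcat (brows 1 mu (uhat (t%:Z - 1)))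
                       (ones_tens n.+1 (us (t%:Z - 1) - v (t%:Z - 1)))))
         (window y (t%:Z - n%:Z) n).

Definition rhs_beta (t : nat) :=
  col_mx
    (col_mx (0 : 'cV[R]_(n * m))
            (ones_tens n.+1 (us t) -
             brows (n + mu) n.+1 U *m (alpha t + omega t)))
    (col_mx (0 : 'cV[R]_(n * p))
            (ones_tens n (ys t) -
             brows (n + mu) n Y *m (alpha t + omega t))).

Record algorithm : Prop := Algorithm {
  alg_v0 : v 0 = v0;
  alg_vN1 : v (- 1) = v0;
  alg_uhatN1 : uhat (- 1) = uhat0;
  alg_usN1 : us (- 1) = v (- 1);
  alg_ys0 : ys 0%N = yhat 0%N;
  alg_v : forall t : nat, v t.+1 = v t - gu *: grad (fu t) (v t);
  alg_omega : forall t : nat, Ha *m omega t = rhs_omega t;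
  alg_alpha : forall t : nat, Ha *m alpha t = rhs_alpha t;
  alg_yhat : forall t : nat,
    yhat t = brow (n + mu) Y *m (alpha t + omega t);
  alg_ys : forall t : nat,
    ys t.+1 = yhat t.+1 - gy *: grad (fy t) (yhat t.+1);
  alg_us : forall t : nat,
    us t = (1%:M - pinv SU *m SU) *m v t - pinv SU *m SY *m ys t;
  alg_beta : forall t : nat, beta t = weighted_sol Q Hb (rhs_beta t);
  alg_uhat : forall t : nat,
    uhat t =
      bcat (brows 1 mu (uhat (t%:Z - 1)))
           (ones_tens 1 (us (t%:Z - 1) - v (t%:Z - 1))) +
      brows n (mu + 1) U *m beta t;
  alg_u : forall t : nat, u t = brow 0 (uhat t) + v t }.

End Algorithm.

(* Main.v *)
Require Import Defs.
From HB Require Import structures.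
From mathcomp Require Import all_boot all_order all_algebra.
From mathcomp Require Import mxtens ring lra zify.
From mathcomp Require Import all_classical all_reals all_analysis.

Set Implicit Arguments.
Unset Strict Implicit.
Unset Printing Implicit Defensive.

Import Order.TTheory GRing.Theory Num.Theory.
Import numFieldNormedType.Exports.
Local Open Scope ring_scope.

(* The minimizers bound the cost in hindsight from below by the sum of the
   f_t(eta_t) + f_t(theta_t), so by Lipschitz continuity the regret is at most a
   multiple of the sum of |u_t - eta_t| + |y_t - theta_t|. It is thus enough that
   these errors are path bounded, i.e. that their sums are bounded by a constant
   plus a multiple of the path lengths of eta and theta.

   By the fundamental lemma of Willems et al., alpha_t + omega_t + beta_t
   represents a trajectory that leads from the current state x_t to the
   equilibrium (us_t, ys_t) in mu steps and stays there. Without the correction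
   beta, the prediction made at time t + 1 is the one made at time t, plus the
   response to the constant input v_(t+1) - v_t. Hence yhat_(t+1) - ys_t and the
   right-hand side that determines beta_(t+1) are linear in the increments of v,
   us and ys. As gradient descent is a contraction towards the minimizer, v
   tracks eta and ys tracks theta up to path bounded errors, so the increments
   of v, us, ys and all beta_t are path bounded. Finally u_t and y_t are the
   first elements of the predicted trajectory and us_t, ys_t its last ones;
   comparing successive predictions along the horizon shows that u_t - us_t and
   y_t - ys_t are path bounded. *)

(** * Euclidean norm and gradient descent *)

Section Euclid.
Variables (R : realType).

Definition dot k (x y : 'cV[R]_k) : R := \sum_i x i 0 * y i 0.

Section Fixed.
Variable k : nat.
Implicit Types x y z : 'cV[R]_k.

Lemma dotC x y : dot x y = dot y x.
Proof. by apply: eq_bigr => i _; rewrite mulrC. Qed.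

Lemma dotDl x y z : dot (x + y) z = dot x z + dot y z.
Proof. by rewrite -big_split; apply: eq_bigr => i _; rewrite mxE mulrDl. Qed.

Lemma dotZl a x y : dot (a *: x) y = a * dot x y.
Proof. by rewrite mulr_sumr; apply: eq_bigr => i _; rewrite mxE mulrA. Qed.

Lemma dotNl x y : dot (- x) y = - dot x y.
Proof. by rewrite -scaleN1r dotZl mulN1r. Qed.

Lemma dotDr x y z : dot x (y + z) = dot x y + dot x z.
Proof. by rewrite dotC dotDl !(dotC x). Qed.

Lemma dotZr a x y : dot x (a *: y) = a * dot x y.
Proof. by rewrite dotC dotZl dotC. Qed.

Lemma dotNr x y : dot x (- y) = - dot x y.
Proof. by rewrite dotC dotNl dotC. Qed.

Definition dotE := (dotDl, dotDr, dotZl, dotZr, dotNl, dotNr).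

Lemma dot_ge0 x : 0 <= dot x x.
Proof. by apply: sumr_ge0 => i _; rewrite -expr2 sqr_ge0. Qed.

Lemma dot_eq0 x : dot x x = 0 -> x = 0.
Proof.
move=> /eqP; rewrite psumr_eq0; last by move=> i _; rewrite -expr2 sqr_ge0.
move=> /allP h; apply/colP => i; rewrite mxE.
by have := h i (mem_index_enum i); rewrite mulf_eq0 orbb => /eqP.
Qed.

Lemma enormE x : enorm x = Num.sqrt (dot x x).
Proof. by congr Num.sqrt; apply: eq_bigr => i _; rewrite expr2. Qed.

Lemma enorm_ge0 x : 0 <= enorm x. Proof. by rewrite enormE sqrtr_ge0. Qed.

Lemma sqr_enorm x : enorm x ^+ 2 = dot x x.
Proof. by rewrite enormE sqr_sqrtr // dot_ge0. Qed.

Lemma enorm0 : enorm (0 : 'cV[R]_k) = 0.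
Proof. by rewrite enormE -(scale0r 0) dotZl mul0r sqrtr0. Qed.

Lemma enormZ a x : enorm (a *: x) = `|a| * enorm x.
Proof.
by rewrite !enormE dotZl dotZr mulrA -expr2 sqrtrM ?sqr_ge0// sqrtr_sqr.
Qed.

Lemma enormN x : enorm (- x) = enorm x.
Proof. by rewrite !enormE dotNl dotNr opprK. Qed.

Lemma enormB x y : enorm (x - y) = enorm (y - x).
Proof. by rewrite -enormN opprB. Qed.

Lemma ler_enorm x y : dot x x <= dot y y -> enorm x <= enorm y.
Proof. by move=> h; rewrite !enormE ler_wsqrtr. Qed.

(** Cauchy-Schwarz: the squared norm of [a *: x - y], a quadratic in [a], is nonnegative at its
    minimizer [dot x y / dot x x]. *)
Lemma dot_le_enorm x y : dot x y <= enorm x * enorm y.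
Proof.
have h a : 0 <= a ^+ 2 * dot x x - 2 * a * dot x y + dot y y.
  have := dot_ge0 (a *: x - y); rewrite !dotE (dotC y x).
  by congr (0 <= _); ring.
rewrite !enormE -sqrtrM ?dot_ge0 //.
have [->|x0] := eqVneq x 0; first by rewrite -(scale0r 0) !dotZl !mul0r sqrtr0.
have xx : 0 < dot x x.
  by rewrite lt_def dot_ge0 andbT; apply: contra_neq x0 => /dot_eq0.
apply: le_trans (ler_norm _) _; rewrite -sqrtr_sqr ler_wsqrtr //.
have := h (dot x y / dot x x).
set q := dot x y; set r := dot x x in xx *; set s := dot y y.
have -> : (q / r) ^+ 2 * r - 2 * (q / r) * q + s = (r * s - q ^+ 2) / r.
  by field; rewrite gt_eqF.
by rewrite pmulr_lge0 ?invr_gt0// subr_ge0.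
Qed.

Lemma enormD x y : enorm (x + y) <= enorm x + enorm y.
Proof.
rewrite -(ler_pXn2r (n := 2)) ?nnegrE ?addr_ge0 ?enorm_ge0//.
rewrite sqrrD !sqr_enorm !dotE (dotC y x).
have := dot_le_enorm x y; lra.
Qed.

Lemma enorm_triangle z x y : enorm (x - y) <= enorm (x - z) + enorm (z - y).
Proof. by apply: le_trans (enormD _ _); rewrite addrA subrK. Qed.

Lemma coord_le_enorm x i : `|x i 0| <= enorm x.
Proof.
rewrite -sqrtr_sqr; apply: ler_wsqrtr.
by rewrite (bigD1 i) //= lerDl sumr_ge0 // => j _; rewrite sqr_ge0.
Qed.

Lemma enorm_le_sum x : enorm x <= \sum_i `|x i 0|.
Proof.
rewrite -(ler_pXn2r (n := 2)) ?nnegrE ?sumr_ge0 ?enorm_ge0//.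
rewrite sqr_enorm /dot expr2 mulr_suml; apply: ler_sum => i _.
rewrite -[leLHS]ger0_norm -?expr2 ?sqr_ge0// normrX expr2 ler_wpM2l //.
by rewrite (bigD1 i) //= lerDl sumr_ge0.
Qed.

End Fixed.
End Euclid.

Section GradientDescent.
Variables (R : realType) (k : nat).
Implicit Types (f : 'cV[R]_k -> R) (x y z d : 'cV[R]_k).

(** [grad] collects partial derivatives; expanding [d] in the standard basis and using linearity of
    the differential covers every direction. *)
Lemma derive_grad f x d : differentiable f x -> 'D_d f x = dot (grad f x) d.
Proof.
move=> df; rewrite deriveE //.
have {1}-> : d = \sum_i d i 0 *: delta_mx i 0.
  apply/colP => i; rewrite summxE (bigD1 i) //= !mxE !eqxx mulr1 big1 ?addr0 //.
  by move=> j ji; rewrite !mxE eq_sym (negbTE ji) mulr0.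
rewrite linear_sum; apply: eq_bigr => i _; rewrite linearZ /= mxE.
by rewrite -deriveE // mulrC.
Qed.

Lemma is_derive_line f x d (s : R) : (forall z, differentiable f z) ->
  is_derive s 1 (fun s => f (x + s *: d)) (dot (grad f (x + s *: d)) d).
Proof.
move=> df; rewrite -derive_grad //.
have eqf : (fun h : R => h^-1 *: (f (x + (h *: 1 + s) *: d) - f (x + s *: d))) =
   (fun h => h^-1 *: (f (h *: d + (x + s *: d)) - f (x + s *: d))).
  apply/funext => h; congr (_ *: (f _ - _)).
  by rewrite [h *: 1]mulr1 scalerDl addrCA.
have : derivable f (x + s *: d) d by apply: diff_derivable.
rewrite /derivable => dv; split; first by rewrite /derivable /= eqf.
by rewrite /derive /= eqf.
Qed.

(** The sign is known only to the right of 0, so the derivative is taken as a right-hand limit. This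
    fits strong convexity, which speaks about segments only. *)
Lemma derive1_right_le0 (f : R -> R) : derivable f 0 1 -> f 0 = 0 ->
  (forall h, 0 < h < 1 -> f h <= 0) -> 'D_1 f 0 <= 0.
Proof.
move=> df f0 fh; rewrite ['D_1 f 0]cvg_at_rightE //.
apply: limr_le.
  rewrite -(cvg_at_rightE (fun h : R => h^-1 *: ((f \o shift 0) _ - f 0))) //.
  apply: cvg_trans df; apply: cvg_app => A [e egt0 Ae].
  by exists e => // x xe xgt0; apply: Ae => //; exact/lt0r_neq0.
near=> h; apply: mulr_ge0_le0.
  by rewrite invr_ge0; apply: ltW; near: h; exists 1 => /=.
rewrite f0 subr0 /= [_%:A]mulr1 addr0; apply: fh.
apply/andP; split; near: h; first by exists 1 => /=.
by exists 1 => //= h; rewrite /= distrC subr0 => /(le_lt_trans (ler_norm _)).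
Unshelve. all: by end_near. Qed.

Lemma is_derive_quadratic (b c s : R) :
  is_derive s 1 (fun s : R => s * b + s ^+ 2 * c) (b + 2 * s * c).
Proof.
have h1 := @is_derive_id R R s 1.
have hb := @is_derive_cst R R R b s 1; have hc := @is_derive_cst R R R c s 1.
have h2 := @is_deriveM R R _ _ s 1 _ _ h1 h1.
have h3 := @is_deriveM R R _ _ s 1 _ _ h1 hb.
have h4 := @is_deriveM R R _ _ s 1 _ _ h2 hc.
have := is_deriveD h3 h4.
rewrite (_ : _ + _ = fun s : R => s * b + s ^+ 2 * c); last first.
  by apply/funext => r; rewrite !fctE expr2.
move=> h5; apply: (@is_derive_eq R R R _ s 1 _ _ h5).
by rewrite /cst !scaler0 !add0r /GRing.scale /=; ring.
Qed.

(** On the segment from [x] to [y], strong convexity bounds [f] by a quadratic in [s] that agrees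
    with [f] at [s = 0]. Hence the derivative at 0 of their difference [g] is nonpositive. *)
Lemma strongly_convex_ge a f x y : (forall z, differentiable f z) ->
  strongly_convex a f ->
  f x + dot (grad f x) (y - x) + a / 2 * enorm (y - x) ^+ 2 <= f y.
Proof.
move=> df sc; set d := y - x.
pose b := f y - f x - a / 2 * enorm d ^+ 2; pose c := a / 2 * enorm d ^+ 2.
have hf := is_derive_line x d 0 df.
have hq := is_derive_quadratic b c 0.
pose g := (fun s : R => f (x + s *: d)) - (fun s : R => s * b + s ^+ 2 * c)
  - cst (f x).
have hg : is_derive (0 : R) (1 : R) g (dot (grad f x) d - b).
  by apply: is_derive_eq; rewrite scale0r addr0 mulr0 mul0r addr0 subr0.
have : 'D_1 g 0 <= 0.
  apply: derive1_right_le0; first by case: hg.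
    rewrite /g !fctE /= scale0r addr0; ring.
  move=> h /andP[h0 h1]; rewrite /g !fctE.
  have := sc y x h; rewrite (ltW h0) (ltW h1) => /(_ isT).
  have -> : h *: y + (1 - h) *: x = x + h *: d.
    by rewrite scalerBr scalerBl scale1r addrCA addrA addrAC.
  by rewrite -/d /b /c; lra.
by rewrite derive_val /b; lra.
Qed.

(** Descent lemma, through the mean value theorem: the quadratic subtracted in [g] is chosen so that
    the Lipschitz bound on the gradient makes [dg] nonpositive between 0 and 1. *)
Lemma smooth_le l f x y : smooth l f ->
  f y <= f x + dot (grad f x) (y - x) + l / 2 * enorm (y - x) ^+ 2.
Proof.
move=> [df sm]; set d := y - x; set D := dot _ d.
pose g := (fun s : R => f (x + s *: d)) -
  (fun s : R => s * D + s ^+ 2 * (l / 2 * enorm d ^+ 2)).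
pose dg (s : R) :=
  dot (grad f (x + s *: d)) d - (D + 2 * s * (l / 2 * enorm d ^+ 2)).
have hg (s : R) : is_derive s 1 g (dg s).
  have hf := is_derive_line x d s df.
  have hq := is_derive_quadratic D (l / 2 * enorm d ^+ 2) s.
  exact: is_derive_eq.
have gc : {within `[0, 1], continuous g}%classic.
  by apply: derivable_within_continuous => s _; case: (hg s).
have [s] := @MVT R g dg 0 1 ltr01 (fun s _ => hg s) gc.
rewrite in_itv /= subr0 mulr1 => /andP[s0 s1].
rewrite /g !fctE scale1r scale0r addr0 [x + d]addrC subrK => e.
suff : dg s <= 0 by move: e; lra.
rewrite /dg /D; set G := grad f _; set G0 := grad f x.
have : dot (G - G0) d <= l * s * enorm d * enorm d.
  apply: le_trans (dot_le_enorm _ _) _; rewrite ler_wpM2r ?enorm_ge0 //.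
  apply: le_trans (sm _ _) _; rewrite addrAC subrr add0r.
  by rewrite enormZ (ger0_norm (ltW s0)) mulrA.
rewrite dotDl dotNl; lra.
Qed.

Variables (a l : R) (f : 'cV[R]_k -> R) (eta : 'cV[R]_k).
Hypotheses (sc : strongly_convex a f) (sm : smooth l f).
Hypothesis eta_min : is_argmin f eta.

Lemma grad_argmin : grad f eta = 0.
Proof.
apply: dot_eq0; set G := grad f eta.
have h s : s * dot G G <= l / 2 * s ^+ 2 * dot G G.
  have := le_trans (eta_min (eta - s *: G)) (smooth_le eta _ sm).
  have -> : eta - s *: G - eta = - (s *: G) by rewrite addrAC subrr add0r.
  rewrite sqr_enorm -/G !dotE; lra.
have := h (`|l| + 1)^-1; have := dot_ge0 G; rewrite le_eqVlt => /predU1P[->//|G0].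
set s := _^-1; have s0 : 0 < s by rewrite invr_gt0 ltr_wpDl.
rewrite ler_pM2r // expr2 mulrA ler_pMl //.
have : l * s < 1.
  rewrite ltr_pdivrMr ?ltr_wpDl// mul1r.
  by rewrite (le_lt_trans (ler_norm l))// ltrDl.
lra.
Qed.

(* Add the strong convexity and smoothness inequalities at the points [eta + w]
   and [x - w]; cocoercivity follows by optimizing over [w]. *)
Lemma cocoercive x w G : G = grad f x - a *: (x - eta) ->
  2 * dot G w - dot G (x - eta) <= (l - a) * dot w w.
Proof.
move=> ->; have df := sm.1.
have := strongly_convex_ge x (eta + w) df sc; have := smooth_le eta (eta + w) sm.
have := strongly_convex_ge eta (x - w) df sc; have := smooth_le x (x - w) sm.
rewrite grad_argmin; set g := grad f x; set d := x - eta.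
have -> : eta + w - x = w - d by rewrite /d opprB addrCA addrA.
have -> : x - w - eta = d - w by rewrite /d addrAC.
have -> : x - w - x = - w by rewrite addrAC subrr add0r.
have -> : eta + w - eta = w by rewrite addrAC subrr add0r.
have dot0 (z : 'cV[R]_k) : dot 0 z = 0 by rewrite -(scale0r 0) dotZl mul0r.
rewrite !sqr_enorm !dotE !dot0 !(dotC w) => h1 h2 h3 h4.
lra.
Qed.

(** With [d = x - eta] and [G = grad f x - a *: d], the new error is [c *: d - gamma *: G] with
    [c = 1 - gamma * a]. The step size bound amounts to [gamma * (l - a) <= 2 * c], and cocoercivity
    then shows that the [G] term does not increase the norm. The maximum with 0 keeps the factor
    nonnegative also where [a <= l] cannot be concluded, as in dimension 0. *)
Lemma gradient_step gamma x : 0 < a -> 0 < gamma <= 2 / (l + a) ->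
  enorm (x - gamma *: grad f x - eta) <= Num.max 0 (1 - gamma * a) * enorm (x - eta).
Proof.
move=> a0 /andP[g0 gle].
have la : 0 < l + a.
  rewrite ltNge; apply/negP => h; have := lt_le_trans g0 gle.
  by rewrite pmulr_rgt0 // invr_gt0 ltNge h.
move: gle; rewrite ler_pdivlMr // => gle.
have coc w := @cocoercive x w _ erefl.
have := smooth_le eta x sm; have := strongly_convex_ge eta x sm.1 sc.
rewrite grad_argmin sqr_enorm.
set d := x - eta in coc *; set G := grad f x - a *: d in coc => h1 h2.
have ed : d = x - eta by []; have eG : G = grad f x - a *: d by [].
clearbody G; clearbody d.
(* The lower and upper quadratic bounds at the minimizer force [a <= l] unless [d = 0]. *)
have : 0 <= (l - a) * dot d d by lra.
have -> : x - gamma *: grad f x - eta = (1 - gamma * a) *: d - gamma *: G.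
  by apply/colP => i; rewrite eG ed !mxE; ring.
have := dot_ge0 d; rewrite le_eqVlt => /predU1P[/esym/dot_eq0 d0 _|d0].
  suff G0 : G = 0 by rewrite d0 G0 !scaler0 subrr enorm0 mulr0.
  move: ed; rewrite eG d0 scaler0 subr0 => /esym/eqP; rewrite subr_eq0 => /eqP ->.
  exact: grad_argmin.
rewrite pmulr_lge0 // => la0.
set c := 1 - gamma * a; have c0 : 0 <= c by rewrite /c; nra.
rewrite max_r //.
suff h : dot (c *: d - gamma *: G) (c *: d - gamma *: G) <= dot (c *: d) (c *: d).
  apply: le_trans (ler_enorm h) _.
  by rewrite enormZ ger0_norm.
suff : gamma * dot G G <= 2 * c * dot G d.
  rewrite !dotE (dotC d G) => h; have := ler_wpM2l (ltW g0) h; lra.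
have gc : gamma * (l - a) <= 2 * c by rewrite /c; lra.
(* Cocoercivity with [w = s *: G]. *)
have hs s : (2 * s - (l - a) * s ^+ 2) * dot G G <= dot G d.
  have := coc (s *: G); rewrite !dotE /=; lra.
(* If [c = 0], then [l = a], and [hs] bounds every multiple of [dot G G] by [dot G d], so
   [G = 0]. *)
move: c0; rewrite le_eqVlt => /predU1P[c0|c0].
  have l_eq_a : l - a = 0 by nra.
  have Gd : dot G G = 0.
    apply: le_anti; rewrite dot_ge0 andbT leNgt; apply/negP => G0.
    have := hs ((dot G d + 1) / dot G G); rewrite l_eq_a mul0r subr0.
    have := hs 0; rewrite mulr0 expr2 !mulr0 subr0 mul0r => Gd0.
    rewrite -mulrA divfK ?gt_eqF//; lra.
  by rewrite Gd -c0 !mulr0 mul0r.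
(* The choice [s = gamma / (2 * c)] avoids a division by [l - a], which may vanish, and loses at
   most half of [gamma * dot G G]. *)
have := ler_wpM2l (ltW c0) (hs (gamma / (2 * c))).
have gg := dot_ge0 G; set q := dot G G in gg *; set e := dot G d => h.
have : gamma * q / 2 <=
    c * ((2 * (gamma / (2 * c)) - (l - a) * (gamma / (2 * c)) ^+ 2) * q).
  have -> : c * ((2 * (gamma / (2 * c)) - (l - a) * (gamma / (2 * c)) ^+ 2) * q) =
      gamma * q * (1 - gamma * (l - a) / (4 * c)) by field; rewrite gt_eqF.
  apply: ler_wpM2l; first by rewrite mulr_ge0// ltW.
  rewrite lerBrDr -lerBrDl ler_pdivrMr ?mulr_gt0//; lra.
by move=> /le_trans /(_ h); rewrite -/q; lra.
Qed.

End GradientDescent.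

(** * Sequences bounded by path lengths *)

Section PathBounded.
Variables (R : realType) (r : nat -> R).
Hypothesis r_ge0 : forall t, 0 <= r t.
Implicit Types (a b : nat -> R).

Definition path_bounded a := exists c K : R, 0 <= K /\
  forall T, \sum_(0 <= t < T) a t <= c + K * \sum_(0 <= t < T) r t.

Lemma path_bounded_le a b : (forall t, a t <= b t) ->
  path_bounded b -> path_bounded a.
Proof.
move=> ab [c [K [K0 h]]]; exists c, K; split=> // T.
by apply: le_trans (h T); apply: ler_sum.
Qed.

Lemma path_bounded0 : path_bounded (fun=> 0).
Proof. by exists 0, 0; split=> // T; rewrite big1// mul0r addr0. Qed.

Lemma path_bounded_id : path_bounded r.
Proof. by exists 0, 1; split=> // T; rewrite add0r mul1r. Qed.

Lemma path_boundedD a b : path_bounded a -> path_bounded b ->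
  path_bounded (fun t => a t + b t).
Proof.
move=> [c [K [K0 h]]] [c' [K' [K'0 h']]]; exists (c + c'), (K + K').
split=> [|T]; first exact: addr_ge0.
by rewrite big_split mulrDl addrACA lerD.
Qed.

Lemma path_boundedZ k a : 0 <= k -> path_bounded a ->
  path_bounded (fun t => k * a t).
Proof.
move=> k0 [c [K [K0 h]]]; exists (k * c), (k * K); split=> [|T].
  exact: mulr_ge0.
by rewrite -mulr_sumr -mulrA -mulrDr ler_wpM2l.
Qed.

Lemma path_bounded_sum (I : Type) (s : seq I) (a : I -> nat -> R) :
  (forall i, path_bounded (a i)) -> path_bounded (fun t => \sum_(i <- s) a i t).
Proof.
move=> h; elim: s => [|i s IH].
  by apply: path_bounded_le path_bounded0 => t; rewrite big_nil.
by apply: path_bounded_le (path_boundedD (h i) IH) => t; rewrite big_cons.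
Qed.

(** The first term moves into the constant; the absolute values also cover the empty sum. *)
Lemma path_bounded_succ a b : (forall t, a t.+1 <= b t) ->
  path_bounded b -> path_bounded a.
Proof.
move=> ab [c [K [K0 h]]]; exists (`|c| + `|a 0%N|), K; split=> // -[|T].
  by rewrite !big_geq // mulr0 addr0 addr_ge0.
have hab : \sum_(0 <= t < T) a t.+1 <= \sum_(0 <= t < T) b t.
  by apply: ler_sum.
have hr : K * \sum_(0 <= t < T) r t <= K * \sum_(0 <= t < T.+1) r t.
  by rewrite ler_wpM2l // big_nat_recr //= lerDl.
rewrite big_nat_recl //.
have := h T; have := ler_norm c; have := ler_norm (a 0%N); lra.
Qed.

(** Summing the recursion bounds the sum of [a] by [k] times itself plus path bounded terms;
    absorbing it on the left costs the factor [(1 - k)^-1]. Prediction errors enter at the old time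
    ([b]), the drift of a minimizer at the new time ([b']). *)
Lemma path_bounded_contraction k a b b' : 0 <= k < 1 ->
  (forall t, 0 <= a t) -> (forall t, 0 <= b t) -> (forall t, 0 <= b' t) ->
  (forall t, a t.+1 <= k * a t + b t + b' t.+1) ->
  path_bounded b -> path_bounded b' -> path_bounded a.
Proof.
move=> /andP[k0 k1] a0 b0 b'0 ab [c [K [K0 h]]] [c' [K' [K'0 h']]].
have k1' : 0 < 1 - k by rewrite subr_gt0.
exists ((1 - k)^-1 * (a 0%N + c + c')), ((1 - k)^-1 * (K + K')); split=> [|T].
  by rewrite mulr_ge0 ?addr_ge0 // invr_ge0 ltW.
rewrite -mulrA -mulrDr ler_pdivlMl // mulrBl mul1r mulrDl.
rewrite lerBlDr; apply: le_trans (_ : a 0%N + k * \sum_(0 <= t < T) a t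
  + \sum_(0 <= t < T) b t + \sum_(0 <= t < T) b' t <= _); last first.
  by have := h T; have := h' T; lra.
case: T => [|T]; first by rewrite !big_geq // mulr0 !addr0.
have hab : \sum_(0 <= t < T) a t.+1 <= k * (\sum_(0 <= t < T) a t) +
    \sum_(0 <= t < T) b t + \sum_(0 <= t < T) b' t.+1.
  by rewrite mulr_sumr -!big_split /=; apply: ler_sum.
have hk : k * \sum_(0 <= t < T) a t <= k * \sum_(0 <= t < T.+1) a t.
  by rewrite ler_wpM2l // big_nat_recr //= lerDl.
have hb : \sum_(0 <= t < T) b t <= \sum_(0 <= t < T.+1) b t.
  by rewrite big_nat_recr //= lerDl.
have hb' : \sum_(0 <= t < T) b' t.+1 <= \sum_(0 <= t < T.+1) b' t.
  by rewrite [leRHS]big_nat_recl //= lerDr.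
rewrite {1}big_nat_recl //; lra.
Qed.

Section Vectors.
Implicit Types k l : nat.

Definition path_bounded_vec k (z : nat -> 'cV[R]_k) :=
  path_bounded (fun t => enorm (z t)).

Lemma path_bounded_vec_coord k (z : nat -> 'cV[R]_k) :
  (forall i, path_bounded (fun t => `|z t i 0|)) -> path_bounded_vec z.
Proof.
by move=> h; apply: path_bounded_le (path_bounded_sum _ h) => t; apply: enorm_le_sum.
Qed.

Lemma path_bounded_coord k (z : nat -> 'cV[R]_k) i :
  path_bounded_vec z -> path_bounded (fun t => `|z t i 0|).
Proof. by apply: path_bounded_le => t; apply: coord_le_enorm. Qed.

Lemma path_bounded_vec0 k : path_bounded_vec (fun=> 0 : 'cV[R]_k).
Proof. by apply: path_bounded_le path_bounded0 => t; rewrite enorm0. Qed.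

Lemma path_bounded_vecD k (z z' : nat -> 'cV[R]_k) :
  path_bounded_vec z -> path_bounded_vec z' -> path_bounded_vec (fun t => z t + z' t).
Proof.
by move=> h h'; apply: path_bounded_le (path_boundedD h h') => t; apply: enormD.
Qed.

Lemma path_bounded_vecN k (z : nat -> 'cV[R]_k) :
  path_bounded_vec z -> path_bounded_vec (fun t => - z t).
Proof. by apply: path_bounded_le => t; rewrite enormN. Qed.

Lemma path_bounded_vecB k (z z' : nat -> 'cV[R]_k) :
  path_bounded_vec z -> path_bounded_vec z' -> path_bounded_vec (fun t => z t - z' t).
Proof. by move=> h h'; apply: path_bounded_vecD h (path_bounded_vecN h'). Qed.

Lemma path_bounded_vec_ext k (z z' : nat -> 'cV[R]_k) : z =1 z' ->
  path_bounded_vec z -> path_bounded_vec z'.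
Proof. by move=> /funext ->. Qed.

Lemma path_bounded_vecM k l (M : 'M[R]_(l, k)) (z : nat -> 'cV[R]_k) :
  path_bounded_vec z -> path_bounded_vec (fun t => M *m z t).
Proof.
move=> h; apply: path_bounded_vec_coord => i.
apply: (@path_bounded_le _ (fun t => \sum_j `|M i j| * `|z t j 0|)).
  move=> t; rewrite mxE; apply: le_trans (ler_norm_sum _ _ _) _.
  by apply: ler_sum => j _; rewrite normrM.
by apply: path_bounded_sum => j; apply: path_boundedZ => //; apply: path_bounded_coord.
Qed.

Lemma path_bounded_vec_succ k (z : nat -> 'cV[R]_k) :
  path_bounded_vec (fun t => z t.+1) -> path_bounded_vec z.
Proof. by apply: path_bounded_succ. Qed.

Lemma path_bounded_vec_col_mx k l (z : nat -> 'cV[R]_k) (z' : nat -> 'cV[R]_l) :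
  path_bounded_vec z -> path_bounded_vec z' ->
  path_bounded_vec (fun t => col_mx (z t) (z' t)).
Proof.
move=> h h'; apply: path_bounded_vec_coord => i.
case: (splitP i) => j ij.
  have -> : i = lshift l j by apply/val_inj.
  by under eq_fun do rewrite col_mxEu; apply: path_bounded_coord.
have -> : i = rshift k j by apply/val_inj.
by under eq_fun do rewrite col_mxEd; apply: path_bounded_coord.
Qed.

(* [w t j] is a prediction made at time [t] for [j] steps ahead, [s t] its final
   value, and [e] the change between successive predictions. *)
Lemma path_bounded_telescope k (mu : nat) (w : nat -> nat -> 'cV[R]_k)
    (s : nat -> 'cV[R]_k) (e : nat -> nat -> 'cV[R]_k) :
  (forall t, w t mu = s t) ->
  (forall t j, (j < mu)%N -> w t.+1 j = w t j.+1 + e j t) ->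
  (forall j, path_bounded_vec (e j)) ->
  path_bounded_vec (fun t => s t.+1 - s t) ->
  path_bounded_vec (fun t => w t 0%N - s t).
Proof.
move=> ws we eb sb.
(* Induction on the distance [d] to the end of the horizon: passing from [t] to [t.+1] brings a
   prediction one step nearer, at the cost of one [e] and one increment of [s]. *)
suff h d : (d <= mu)%N -> path_bounded_vec (fun t => w t (mu - d)%N - s t).
  by have := h mu (leqnn mu); rewrite subnn.
elim: d => [_|d IH dmu].
  apply: path_bounded_vec_ext (path_bounded_vec0 _) => t.
  by rewrite subn0 ws subrr.
apply: path_bounded_vec_succ.
apply: path_bounded_vec_ext
  (path_bounded_vecB (path_bounded_vecD (IH (ltnW dmu)) (eb (mu - d.+1)%N)) sb) => t.
have jmu : (mu - d.+1 < mu)%N by lia.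
rewrite we // -subSn // subSS; apply/colP => i; rewrite !mxE; ring.
Qed.

End Vectors.
End PathBounded.

(** * The Moore-Penrose pseudoinverse *)

Section Pinv.
Variable R : realType.

(** The diagonal of the Gram matrix holds the squared norms of the rows. *)
Lemma mulmxtr_eq0 a b (M : 'M[R]_(a, b)) : M *m M^T = 0 -> M = 0.
Proof.
move=> h; apply/row_matrixP => i; rewrite row0; apply: (can_inj trmxK).
rewrite trmx0; apply: dot_eq0.
have := congr1 (fun N : 'M[R]_a => N i i) h; rewrite !mxE => e; rewrite -[RHS]e.
by apply: eq_bigr => j _; rewrite !mxE.
Qed.

Lemma row_free_gram r b (G : 'M[R]_(r, b)) : row_free G -> G *m G^T \in unitmx.
Proof.
move=> fG; rewrite -row_free_unit; apply/row_freeP.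
have k0 : kermx (G *m G^T) = 0.
  have := mulmx_ker (G *m G^T); set K := kermx _ => h.
  have : K *m G = 0.
    apply: mulmxtr_eq0; rewrite trmx_mul !mulmxA -(mulmxA _ G) h.
    by rewrite mul0mx.
  by move/(congr1 (mulmxr (pinvmx G))); rewrite /= -mulmxA mulmxVp // mulmx1 mul0mx.
by apply/row_freeP; rewrite -kermx_eq0 k0.
Qed.

(** The witness comes from a full rank factorization [M = F *m G], for which both Gram matrices are
    invertible. *)
Lemma is_pinv_exists a b (M : 'M[R]_(a, b)) : exists X, is_pinv M X.
Proof.
move: (mulmx_base M) (col_base_full M) (row_base_free M).
move: (col_base M) (row_base M); move: (\rank M) => r F G <- fF /row_free_gram GU.
have FU : F^T *m F \in unitmx.
  rewrite -{2}[F]trmxK; apply: row_free_gram.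
  by rewrite /row_free mxrank_tr; exact: fF.
exists (G^T *m invmx (G *m G^T) *m (invmx (F^T *m F) *m F^T)).

have FX : (F *m G) *m (G^T *m invmx (G *m G^T) *m (invmx (F^T *m F) *m F^T)) =
   F *m invmx (F^T *m F) *m F^T.
  by rewrite !mulmxA -(mulmxA F G) -(mulmxA F (G *m _)) mulmxV // mulmx1.
have XF : (G^T *m invmx (G *m G^T) *m (invmx (F^T *m F) *m F^T)) *m (F *m G) =
   G^T *m invmx (G *m G^T) *m G.
  rewrite !mulmxA -(mulmxA _ F^T F) -(mulmxA _ (invmx (F^T *m F))) mulVmx //.
  by rewrite mulmx1.
split.
- by rewrite FX mulmxA -(mulmxA _ F^T F) -(mulmxA F) mulVmx // mulmx1.
- by rewrite XF -!mulmxA (mulmxA G G^T) (mulmxA (invmx _) (G *m G^T)) mulVmx // mul1mx.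
- by rewrite FX !trmx_mul trmx_inv trmx_mul !trmxK mulmxA.
- by rewrite XF !trmx_mul trmx_inv trmx_mul !trmxK mulmxA.
Qed.

Lemma pinvP a b (M : 'M[R]_(a, b)) : is_pinv M (Defs.pinv M).
Proof. exact: (@xgetPex _ 0 [set X | is_pinv M X]%classic (is_pinv_exists M)). Qed.

Lemma mulmx_pinv_fix a b c (M : 'M[R]_(a, b)) (x : 'M[R]_(b, c)) :
  M *m Defs.pinv M *m (M *m x) = M *m x.
Proof. by rewrite mulmxA; case: (pinvP M) => ->. Qed.

(** Feasible right-hand sides are met exactly: [pinv H *m g] solves the constraint, and the
    correction does not disturb it. Indeed the Penrose identities write [X = pinv (Q *m P)] as
    [P *m Q^T *m X^T *m X], where [P] projects onto the kernel of [H]. *)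
Lemma mulmx_weighted_sol q a c (Q : 'M[R]_(q, c)) (H : 'M[R]_(a, c)) x :
  H *m weighted_sol Q H (H *m x) = H *m x.
Proof.
rewrite /weighted_sol; set P := 1%:M - Defs.pinv H *m H.
have HP : H *m P = 0.
  by rewrite mulmxBr mulmx1 mulmxA; case: (pinvP H) => ->; rewrite subrr.
have PT : P^T = P by rewrite linearB /= trmx1; case: (pinvP H) => _ _ _ ->.
suff HX : H *m Defs.pinv (Q *m P) = 0.
  rewrite (mulmxA H) (mulmxBr H) mulmx1 (mulmxA H) HX mul0mx subr0.
  by rewrite mulmxA mulmx_pinv_fix.
case: (pinvP (Q *m P)) => _ XE _ XT.
by rewrite -XE -XT !trmx_mul PT !mulmxA HP !mul0mx.
Qed.

End Pinv.

(** * Block matrices and linear systems *)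

Section BlockLemmas.
Variable R : realType.

Lemma browE m c L (i : 'I_L) (M : 'M[R]_(L * m, c)) r j :
  brow i M r j = M (mxtens_index (i, r)) j.
Proof. by rewrite mxE valK. Qed.

Lemma brow_inj m c L (M N : 'M[R]_(L * m, c)) :
  (forall i, (i < L)%N -> brow i M = brow i N) -> M = N.
Proof.
move=> h; apply/matrixP => k j; case: (mxtens_indexP k) => i r.
by rewrite -!browE h.
Qed.

Lemma brow_mul m c d L i (M : 'M[R]_(L * m, c)) (N : 'M[R]_(c, d)) :
  brow i (M *m N) = brow i M *m N.
Proof.
apply/matrixP => r j; rewrite !mxE; under [RHS]eq_bigr do rewrite mxE.
case: insubP => [i' _ _|_]; first by rewrite mxE.
by rewrite big1 // => k _; rewrite mul0r.
Qed.

Lemma browD m c L i (M N : 'M[R]_(L * m, c)) : brow i (M + N) = brow i M + brow i N.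
Proof.
apply/matrixP => r j; rewrite !mxE.
by case: insubP => [i' _ _|_]; rewrite ?mxE ?addr0.
Qed.

Lemma browN m c L i (M : 'M[R]_(L * m, c)) : brow i (- M) = - brow i M.
Proof.
apply/matrixP => r j; rewrite !mxE.
by case: insubP => [i' _ _|_]; rewrite ?mxE ?oppr0.
Qed.

Lemma brow0 m c L i : brow i (0 : 'M[R]_(L * m, c)) = 0.
Proof.
apply/matrixP => r j; rewrite !mxE.
by case: insubP => [i' _ _|_]; rewrite ?mxE.
Qed.

Lemma brow_blockcol m c L (F : nat -> 'M[R]_(m, c)) i : (i < L)%N ->
  brow i (blockcol L F) = F i.
Proof.
move=> iL; apply/matrixP => r j.
by rewrite (browE (Ordinal iL)) mxE mxtens_indexK.
Qed.

Lemma brow_brows m c L a l i (M : 'M[R]_(L * m, c)) : (i < l)%N ->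
  brow i (brows a l M) = brow (a + i) M.
Proof. exact: brow_blockcol. Qed.

Lemma brow_ones_tens m c k i (M : 'M[R]_(m, c)) : (i < k)%N ->
  brow i (ones_tens k M) = M.
Proof.
move=> ik; apply/matrixP => r j; rewrite (browE (Ordinal ik)) castmxE !mxE.
rewrite cast_ord_id mxtens_indexK mul1r /=; congr (M _ _).
by apply/val_inj => /=; rewrite modn_small.
Qed.

Lemma brow_bcatl m c k l i (M : 'M[R]_(k * m, c)) (N : 'M[R]_(l * m, c)) :
  (i < k)%N -> brow i (bcat M N) = brow i M.
Proof.
move=> ik; have ikl : (i < k + l)%N by apply: ltn_addr.
apply/matrixP => r j; rewrite (browE (Ordinal ikl)) (browE (Ordinal ik)) castmxE.
rewrite cast_ord_id -(col_mxEu M N); congr (col_mx _ _ _ _).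
exact/val_inj.
Qed.

Lemma brow_bcatr m c k l i (M : 'M[R]_(k * m, c)) (N : 'M[R]_(l * m, c)) :
  (i < l)%N -> brow (k + i) (bcat M N) = brow i N.
Proof.
move=> il; have ikl : (k + i < k + l)%N by rewrite ltn_add2l.
apply/matrixP => r j; rewrite (browE (Ordinal ikl)) (browE (Ordinal il)) castmxE.
rewrite cast_ord_id -(col_mxEd M N); congr (col_mx _ _ _ _).
by apply/val_inj; rewrite /= mulnDl addnA.
Qed.

Lemma brow_window m (z : int -> 'cV[R]_m) a l i : (i < l)%N ->
  brow i (window z a l) = z (a + i%:Z).
Proof. exact: brow_blockcol. Qed.

Lemma mul_tr_blockcol m a b L (F : nat -> 'M[R]_(m, a)) (G : nat -> 'M[R]_(m, b)) :
  (blockcol L F)^T *m blockcol L G = \sum_(i < L) (F i)^T *m G i.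
Proof.
apply/matrixP => r c; rewrite mxE summxE.
under [RHS]eq_bigr do rewrite mxE.
rewrite pair_bigA /= (reindex (@mxtens_unindex L m)) /=; last first.
  by exists (@mxtens_index L m) => k _; rewrite ?mxtens_indexK ?mxtens_unindexK.
by apply: eq_bigr => k _; rewrite !mxE.
Qed.

(* [comb z g i] is block [i] of [hankel N L z *m g]. *)
Definition comb m c (z : nat -> 'cV[R]_m) (g : 'cV[R]_c) (i : nat) : 'cV[R]_m :=
  \sum_j g j 0 *: z (i + j)%N.

Lemma brow_hankel_mul m N L (z : nat -> 'cV[R]_m) (g : 'cV[R]_(ncols N L)) i :
  (i < L)%N -> brow i (hankel N L z *m g) = comb z g i.
Proof.
move=> iL; rewrite brow_mul brow_blockcol //; apply/colP => r.
by rewrite mxE summxE; apply: eq_bigr => j _; rewrite !mxE mulrC.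
Qed.

Lemma combD m c (z : nat -> 'cV[R]_m) (g g' : 'cV[R]_c) i :
  comb z (g + g') i = comb z g i + comb z g' i.
Proof. by rewrite -big_split; apply: eq_bigr => j _; rewrite mxE scalerDl. Qed.

End BlockLemmas.

(** * State trajectories, observability and controllability *)

Section LTI.
Variables (R : realType) (n m p : nat) (S : lti R n m p).
Local Notation A := (sysA S).
Local Notation B := (sysB S).
Local Notation C := (sysC S).
Local Notation D := (sysD S).
Implicit Types (x : 'cV[R]_n) (u : nat -> 'cV[R]_m).

Fixpoint state x u (k : nat) : 'cV[R]_n :=
  if k is k'.+1 then A *m state x u k' + B *m u k' else x.

Lemma eq_state x u u' k : (forall i, (i < k)%N -> u i = u' i) ->
  state x u k = state x u' k.
Proof.
elim: k => //= k IH h; rewrite h // IH // => i ik; exact: h (ltnW _).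
Qed.

Lemma stateD x x' u u' k :
  state (x + x') (fun i => u i + u' i) k = state x u k + state x' u' k.
Proof. by elim: k => //= k ->; rewrite !mulmxDr addrACA. Qed.

Lemma stateB x x' u u' k :
  state (x - x') (fun i => u i - u' i) k = state x u k - state x' u' k.
Proof. by elim: k => //= k ->; rewrite !mulmxBr opprD addrACA. Qed.

Lemma state_add x u i k :
  state x u (i + k) = state (state x u i) (fun j => u (i + j)%N) k.
Proof. by elim: k => [|k IH]; rewrite ?addn0 // addnS /= IH. Qed.

Lemma state_unique (xx : nat -> 'cV[R]_n) u L :
  (forall k, (k < L)%N -> xx k.+1 = A *m xx k + B *m u k) ->
  forall k, (k <= L)%N -> xx k = state (xx 0%N) u k.
Proof. by move=> h; elim=> // k IH kL; rewrite h //= IH // ltnW. Qed.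

Lemma state_const x us k : x = A *m x + B *m us -> state x (fun=> us) k = x.
Proof. by move=> h; elim: k => //= k ->. Qed.

Lemma mulmx_exprS k : A *m A ^+ k = A ^+ k.+1.
Proof. by rewrite exprS. Qed.

Lemma state_sum x u k :
  state x u k = A ^+ k *m x + \sum_(i < k) A ^+ (k.-1 - i) *m B *m u i.
Proof.
elim: k => [|k IH]; first by rewrite big_ord0 expr0 addr0 mul1mx.
rewrite /= {}IH mulmxDr mulmxA mulmx_exprS -addrA; congr (_ + _).
rewrite big_ord_recr /= subnn expr0 mul1mx; congr (_ + _).
rewrite mulmx_sumr; apply: eq_bigr => i _; rewrite !mulmxA mulmx_exprS.
by congr (_ ^+ _ *m _ *m _); have := ltn_ord i; lia.
Qed.

Lemma state0 k : state 0 (fun=> 0) k = 0.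
Proof. by apply: state_const; rewrite !mulmx0 addr0. Qed.

Definition step_gain k : 'M[R]_(n, m) := \sum_(i < k) A ^+ (k.-1 - i) *m B.

Lemma state_step d k : state 0 (fun=> d) k = step_gain k *m d.
Proof. by rewrite state_sum mulmx0 add0r mulmx_suml. Qed.

Section Observability.
Hypothesis obs : observable S.

Lemma obs_eq0 x : (forall i, (i < n)%N -> C *m A ^+ i *m x = 0) -> x = 0.
Proof.
move=> h; set M := \mxcol_(i < n) (C *m A ^+ i).
have Mx : M *m x = 0.
  rewrite /M mxcol_mul; apply/mxcolP => i; rewrite mxcolK submxcol0.
  exact: h.
have : row_full M by apply/eqP.
by move=> /row_fullP[M' M'M]; rewrite -[x]mul1mx -M'M -mulmxA Mx mulmx0.
Qed.

(** By linearity the difference of the two trajectories is an input-free trajectory with zero output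
    during [n] steps. *)
Lemma obs_state x x' u u' : (forall i, (i < n)%N -> u i = u' i) ->
  (forall i, (i < n)%N -> C *m state x u i + D *m u i =
                          C *m state x' u' i + D *m u' i) ->
  x = x'.
Proof.
move=> eu ey; apply/eqP; rewrite -subr_eq0; apply/eqP; apply: obs_eq0 => i iN.
have := ey i iN; rewrite eu // => /addIr /eqP; rewrite -subr_eq0 -mulmxBr -stateB.
rewrite (@eq_state _ _ (fun=> 0)).
  by rewrite state_sum big1 => [|j _]; rewrite ?mulmx0 // addr0 mulmxA => /eqP.
by move=> j ji; rewrite eu ?subrr // (ltn_trans ji).
Qed.

Definition is_equil us ys x := x = A *m x + B *m us /\ ys = C *m x + D *m us.

(** [equilibrium] constrains only inputs and outputs. Since it covers [n.+1] steps, the states at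
    times 0 and 1 both produce the same [n] outputs under the same input, so by observability they
    coincide. *)
Lemma equilibriumP us ys : equilibrium S us ys <-> exists x, is_equil us ys x.
Proof.
split=> [[x0 [xx [_ h]]]|[x [ex ey]]]; last first.
  by exists x, (fun=> x); split=> // k _.
exists (xx 0%N); have [e0 ey] := h 0%N (ltn0Sn n); split=> //.
rewrite -e0.
have hx k : (k < n.+1)%N -> xx k.+1 = A *m xx k + B *m us by move=> /h[].
have st k : (k <= n.+1)%N -> xx k = state (xx 0%N) (fun=> us) k.
  exact: (@state_unique xx (fun=> us) n.+1 hx).
apply: (@obs_state _ _ (fun=> us) (fun=> us)) => // i iN.
have <- : xx i.+1 = state (xx 1%N) (fun=> us) i.
  rewrite st 1?ltnS 1?ltnW // (st 1%N) //.
  exact: (state_add _ (fun=> us) 1 i).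
rewrite -st; last exact: leqW (ltnW iN).
by case: (h i (leqW iN)) => _ <-; case: (h i.+1 iN) => _ <-.
Qed.

End Observability.

Lemma ctrb_reach k x : \rank (ctrb_mx S k) = n -> exists w, state 0 w k = x.
Proof.
move=> rk; have : row_free (ctrb_mx S k) by rewrite /row_free rk.
move=> /row_freeP[M cM]; pose c := M *m x.
pose c' (i : nat) := if insub i is Some i' then submxcol c i' else 0.
exists (fun i => c' (k.-1 - i)%N).
rewrite state_sum mulmx0 add0r (reindex_inj rev_ord_inj) /=.
have -> : x = ctrb_mx S k *m c by rewrite mulmxA cM mul1mx.
rewrite -[in RHS](submxcolK c) mul_mxrow_mxcol; apply: eq_bigr => i _.
have -> : (k.-1 - (k - i.+1) = i)%N by have := ltn_ord i; lia.
by rewrite /c' valK.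
Qed.

(** Rest at the origin for [k - kc] steps, then steer. *)
Lemma ctrb_index_reach kc k x : is_ctrb_index S kc -> (kc <= k)%N ->
  exists w, state 0 w k = x.
Proof.
move=> [/ctrb_reach r _] kck; have [w <-] := r x.
pose w' i := if (i < k - kc)%N then 0 else w (i - (k - kc))%N.
exists w'; have := state_add 0 w' (k - kc) kc; rewrite subnK // => ->.
rewrite (@eq_state _ w' (fun=> 0) (k - kc)); last first.
  by move=> i ik; rewrite /w' ik.
by rewrite state0; apply: eq_state => i _; rewrite /w' ltnNge leq_addr /= addKn.
Qed.

(** Cayley-Hamilton in coefficients. In dimension 0 all matrices are equal. *)
Lemma char_poly_coefs : exists a : nat -> R,
  a n = 1 /\ \sum_(k < n.+1) a k *: A ^+ k = 0.
Proof.
move: (sysA S); case: n => [|n'] M.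
  by exists (fun=> 1); split=> //; apply/matrixP => -[].
exists (fun k => (char_poly M)`_k); split.
  by have /monicP := char_poly_monic M; rewrite lead_coefE size_char_poly.
transitivity (horner_mx M (char_poly M)); last exact: Cayley_Hamilton.
rewrite -[X in horner_mx M X]coefK.
rewrite size_char_poly poly_def rmorph_sum /=. apply: eq_bigr => k _.
by rewrite linearZ /= rmorphXn /= horner_mx_X.
Qed.

End LTI.

(** * Persistency of excitation and the fundamental lemma *)

Section FundamentalLemma.
Variables (R : realType) (n m p : nat) (S : lti R n m p).
Local Notation A := (sysA S).
Local Notation B := (sysB S).

(** Full row rank as triviality of the left kernel, with its vectors cut into blocks; in this form
    windows can be shifted and padded. *)
Lemma persistently_exciting_ker N L (z : nat -> 'cV[R]_m) :
  persistently_exciting N L z <->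
  forall h : nat -> 'rV[R]_m,
    (forall j, (j < ncols N L)%N -> \sum_(i < L) h i *m z (i + j)%N = 0) ->
    forall i, (i < L)%N -> h i = 0.
Proof.
rewrite /persistently_exciting -[(m * L)%N]mulnC.
have key (h : nat -> 'rV[R]_m) j (jN : (j < ncols N L)%N) :
    ((blockcol L (fun i => (h i)^T))^T *m hankel N L z) 0 (Ordinal jN) =
    (\sum_(i < L) h i *m z (i + j)%N) 0 0.
  rewrite mul_tr_blockcol !summxE; apply: eq_bigr => i _.
  by rewrite trmxK !mxE; apply: eq_bigr => k _; rewrite !mxE.
split=> [rk h hz i iL|h].
  have /row_free_inj inj : row_free (hankel N L z) by rewrite /row_free rk.
  apply: (can_inj trmxK); rewrite trmx0.
  have v0 : (blockcol L (fun i => (h i)^T))^T = 0.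
    apply: inj; rewrite mul0mx; apply/rowP => -[j jN].
    by rewrite key hz // !mxE.
  rewrite -(brow_blockcol (fun i => (h i)^T) iL) -[blockcol _ _]trmxK v0 trmx0.
  exact: brow0.
apply/eqP/inj_row_free => v vH; apply: (can_inj trmxK); rewrite trmx0.
apply: brow_inj => i iL; rewrite brow0 -[LHS]trmxK.
rewrite (h (fun i => (brow i v^T)^T)) ?trmx0 // => j jN.
apply/matrixP => a b; rewrite !ord1 -(key (fun i => (brow i v^T)^T) _ jN).
rewrite (_ : blockcol _ _ = v^T) ?trmxK ?vH ?mxE //.
by apply: brow_inj => k kL; rewrite brow_blockcol // trmxK.
Qed.

(** Weights that annihilate all windows of length [L'], padded with zeros, annihilate those of
    length [L]. *)
Lemma persistently_exciting_le N L L' (z : nat -> 'cV[R]_m) : (L' <= L)%N ->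
  persistently_exciting N L z -> persistently_exciting N L' z.
Proof.
move=> LL /persistently_exciting_ker pe; apply/persistently_exciting_ker => h hz i iL.
pose h' i := if (i < L')%N then h i else 0.
have -> : h i = h' i by rewrite /h' iL.
apply: pe (leq_trans iL LL) => j jN.
rewrite -(subnKC LL) big_split_ord /= [X in _ + X]big1 ?addr0; last first.
  by move=> k _; rewrite /h' ltnNge leq_addr /= mul0mx.
rewrite -[RHS](hz j); last by apply: leq_trans jN _; apply: leq_sub2l.
by apply: eq_bigr => k _; rewrite /h' ltn_ord.
Qed.

Variables (N L : nat) (ud : nat -> 'cV[R]_m) (xd : nat -> 'cV[R]_n).
Hypothesis ctrb : controllable S.
Hypothesis xdE : forall k, (k < N)%N -> xd k.+1 = A *m xd k + B *m ud k.
Hypothesis pe : persistently_exciting N (L + n) ud.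

(* With [chi = sum_k a_k X^k] the characteristic polynomial of [A], the weights
   [H i = sum_k a_k h (i + n - k)] annihilate all windows of the input of length
   [L + n], because the contributions of the states add up to [xi chi(A)]. As [h]
   vanishes from [n + L] on and [a_n = 1], [H = 0] forces [h = 0] by descending
   induction. *)
Lemma input_state_annihilator (xi : 'rV[R]_n) (eta : nat -> 'rV[R]_m) :
  (forall j, (j < ncols N L)%N ->
    xi *m xd j + \sum_(i < L) eta i *m ud (i + j)%N = 0) ->
  xi = 0 /\ forall i, (i < L)%N -> eta i = 0.
Proof.
move=> ann.
pose h s := if (s < n)%N then xi *m A ^+ (n.-1 - s) *m B
            else if (s < n + L)%N then eta (s - n)%N else 0.
have [a [an aA]] := char_poly_coefs S.
(* This is the relation [ann] at time [j + k], with [xd (j + k)] expanded from [xd j]: the inputs of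
   the expansion get the first part of [h] as weights. *)
have hann j k : (j < ncols N (L + n))%N -> (k <= n)%N ->
    \sum_(i < L + n) h (i + n - k)%N *m ud (i + j)%N = - (xi *m A ^+ k *m xd j).
  move=> jN kn; have jkN : (j + k < ncols N L)%N by move: jN; rewrite /ncols; lia.
  have jk : (j + k <= N)%N by move: jN; rewrite /ncols; lia.
  have ex : xd (j + k)%N = A ^+ k *m xd j +
      \sum_(i < k) A ^+ (k.-1 - i) *m B *m ud (i + j)%N.
    have st i : (i <= N)%N -> xd i = state S (xd 0%N) ud i by exact: state_unique.
    rewrite st // state_add -st ?state_sum; last by lia.
    by congr (_ + _); apply: eq_bigr => i _; rewrite addnC.
  have := ann _ jkN; rewrite ex mulmxDr -addrA => /eqP.
  rewrite addr_eq0 mulmxA => /eqP ->; rewrite opprK.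
  rewrite -(big_mkord xpredT (fun i => h (i + n - k)%N *m ud (i + j)%N)).
  (* The first [k] inputs stem from the expanded state, the next [L] from [eta]; the remaining
     weights vanish. *)
  rewrite (big_cat_nat (n := k)) /=; [|by []|by lia].
  rewrite (big_cat_nat (m := k) (n := (k + L)%N)) /=; [|by lia|by lia].
  rewrite [X in _ + (_ + X)]big_nat_cond [X in _ + (_ + X)]big1 ?addr0; last first.
    by move=> i /andP[/andP[ki _] _]; rewrite /h !ifN ?mul0mx // -leqNgt; lia.
  rewrite big_mkord mulmx_sumr; congr (_ + _).
    apply: eq_bigr => i _; have ik := ltn_ord i; rewrite /h ifT; last by lia.
    by rewrite !mulmxA; congr (xi *m _ ^+ _ *m _ *m _); lia.
  rewrite [LHS](big_addn 0 _ k xpredT) addKn big_mkord.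
  apply: eq_bigr => i _.
  have iL := ltn_ord i; rewrite /h ifN; last by rewrite -leqNgt; lia.
  rewrite ifT; last by lia.
  by congr (eta _ *m ud _); lia.
pose H i := \sum_(k < n.+1) a k *: h (i + n - k)%N.
have H0 i : (i < L + n)%N -> H i = 0.
  move: i; apply: (persistently_exciting_ker N (L + n) ud).1 => // j jN.
  transitivity (\sum_(k < n.+1) a k *: \sum_(i < L + n) h (i + n - k)%N *m ud (i + j)%N).
    under eq_bigr do rewrite mulmx_suml.
    rewrite exchange_big /=; apply: eq_bigr => k _; rewrite scaler_sumr.
    by apply: eq_bigr => i _; rewrite scalemxAl.
  transitivity (- (xi *m (\sum_(k < n.+1) a k *: A ^+ k) *m xd j)).
    rewrite mulmx_sumr mulmx_suml -sumrN; apply: eq_bigr => k _.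
    by rewrite hann // -1?ltnS // -scalemxAr -scalemxAl scalerN.
  by rewrite aA mulmx0 mul0mx oppr0.
have h0 d : forall s, (n + L <= s + d)%N -> h s = 0.
  elim: d => [|d IH] s sd; first by rewrite /h !ifN // -leqNgt; lia.
  have [sL|Ls] := ltnP s (L + n); last by rewrite /h !ifN // -leqNgt; lia.
  have := H0 s sL; rewrite /H big_ord_recr /= an scale1r addnK big1 ?add0r //.
  by move=> k _; have kn := ltn_ord k; rewrite IH ?scaler0 //; lia.
split=> [|i iL]; last first.
  have := h0 (n + L)%N (n + i)%N (leq_addl _ _).
  by rewrite /h ltnNge leq_addr /= ltn_add2l iL addKn.
(* The blocks of [h] below [n] are the products of [xi] with the blocks of the controllability
   matrix. *)
have : row_free (ctrb_mx S n) by rewrite /row_free ctrb.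
move=> /row_free_inj; apply; rewrite mul0mx mul_mxrow.
apply/mxrowP => i; rewrite mxrowK submxrow0; have iN := ltn_ord i.
have := h0 (n + L)%N (n.-1 - i)%N (leq_addl _ _); rewrite /h ifT; last by lia.
by rewrite -mulmxA; have -> : (n.-1 - (n.-1 - i) = i)%N by lia.
Qed.

(** By [input_state_annihilator], the stacked state and input data have full row rank; a right
    inverse realizes any initial state and any input by a combination of data windows. *)
Lemma fundamental_lemma (z : 'cV[R]_n) (b : nat -> 'cV[R]_m) :
  exists g : 'cV[R]_(ncols N L),
    comb xd g 0 = z /\ forall i, (i < L)%N -> comb ud g i = b i.
Proof.
pose X : 'M[R]_(n, ncols N L) := \matrix_(r, j) xd j r 0.
have /row_freeP[M XM] : row_free (col_mx X (hankel N L ud)).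
  apply: inj_row_free => v; rewrite -[v]hsubmxK mul_row_col.
  set xi := lsubmx v; set et := rsubmx v => h.
  have [|-> e0] := @input_state_annihilator xi (fun i => (brow i et^T)^T).
    move=> j jN; apply/matrixP => r c; rewrite !ord1 {r c}.
    have e : (xi *m X + et *m hankel N L ud) 0 (Ordinal jN) = 0 by rewrite h mxE.
    rewrite [RHS]mxE -[RHS]e [LHS]mxE [RHS]mxE; congr (_ + _).
      by rewrite !mxE; apply: eq_bigr => k _; rewrite !mxE.
    have -> : et = (blockcol L (fun i => brow i et^T))^T.
      apply: (can_inj trmxK); rewrite trmxK; apply: brow_inj => i iL.
      by rewrite brow_blockcol.
    rewrite mul_tr_blockcol !summxE; apply: eq_bigr => i _.
    rewrite -(_ : brow i et^T = brow i (blockcol L (fun i => brow i et^T))^T^T).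
      by rewrite !mxE; apply: eq_bigr => k _; rewrite !mxE.
    by rewrite trmxK brow_blockcol.
  suff -> : et = 0 by rewrite row_mx0.
  apply: (can_inj trmxK); rewrite trmx0; apply: brow_inj => i iL.
  by rewrite brow0 -[LHS]trmxK e0 // trmx0.
pose g := M *m col_mx z (blockcol L b); exists g.
have : col_mx X (hankel N L ud) *m g = col_mx z (blockcol L b).
  by rewrite mulmxA XM mul1mx.
rewrite mul_col_mx => /eq_col_mx[Xg Ug]; split=> [|i iL].
  rewrite -Xg; apply/colP => r; rewrite summxE mxE; apply: eq_bigr => j _.
  by rewrite !mxE mulrC.
by rewrite -(brow_hankel_mul _ _ iL) Ug brow_blockcol.
Qed.
End FundamentalLemma.

(** * Trajectories generated by the data *)

Section DataTrajectories.
Variables (R : realType) (n m p N : nat) (S : lti R n m p).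
Variables (ud : nat -> 'cV[R]_m) (yd : nat -> 'cV[R]_p) (xd : nat -> 'cV[R]_n).
Hypothesis data_traj : forall k, (k < N)%N -> sys_eq S (xd k) (xd k.+1) (ud k) (yd k).
Local Notation A := (sysA S).
Local Notation B := (sysB S).
Local Notation C := (sysC S).
Local Notation D := (sysD S).

(** Combinations of data windows are trajectories. States reach up to index [L], one step beyond the
    inputs, as the last column still leaves room for that transition. *)
Lemma comb_state L (g : 'cV[R]_(ncols N L)) i k : (i + k <= L)%N ->
  comb xd g (i + k) = state S (comb xd g i) (fun j => comb ud g (i + j)) k.
Proof.
elim: k => [|k IH] ikL; first by rewrite addn0.
rewrite /= -IH; last by lia.
rewrite /comb !mulmx_sumr -big_split; apply: eq_bigr => j _ /=.
rewrite -!scalemxAr -scalerDr addnS addSn; congr (_ *: _).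
have ji := ltn_ord j; case: (@data_traj (i + k + j)%N) => //.
by move: ji; rewrite {2}/ncols; lia.
Qed.

Lemma comb_output L (g : 'cV[R]_(ncols N L)) i : (i < L)%N ->
  comb yd g i = C *m comb xd g i + D *m comb ud g i.
Proof.
move=> iL; rewrite /comb !mulmx_sumr -big_split; apply: eq_bigr => j _ /=.
rewrite -!scalemxAr -scalerDr; congr (_ *: _).
have ji := ltn_ord j; case: (@data_traj (i + j)%N) => //.
by move: ji; rewrite {2}/ncols; lia.
Qed.

Lemma brow_brows_hankel_mul k L (z : nat -> 'cV[R]_k) (g : 'cV[R]_(ncols N L)) a l i :
  (i < l)%N -> (a + i < L)%N ->
  brow i (brows a l (hankel N L z) *m g) = comb z g (a + i).
Proof. by move=> il aiL; rewrite brow_mul brow_brows // -brow_mul brow_hankel_mul. Qed.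

Lemma mul_ones_tens k c d (M : 'M[R]_(k, c)) (P : 'M[R]_(c, d)) l :
  ones_tens l M *m P = ones_tens l (M *m P).
Proof. by apply: brow_inj => i il; rewrite brow_mul !brow_ones_tens. Qed.

Hypotheses (obs : observable S) (ctrb : controllable S).

Lemma comb_state_eq0 L (g : 'cV[R]_(ncols N L)) : (n <= L)%N ->
  (forall i, (i < n)%N -> comb ud g i = 0) ->
  (forall i, (i < n)%N -> comb yd g i = 0) -> comb xd g n = 0.
Proof.
move=> nL gu gy.
have st i : (i <= n)%N -> comb xd g i = state S (comb xd g 0) (fun=> 0) i.
  move=> iN; rewrite (@comb_state _ g 0 i) ?(leq_trans iN) //.
  by apply: eq_state => j ji; rewrite gu // (leq_trans ji).
rewrite st // (_ : comb xd g 0 = 0) ?state0 //.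
apply: (@obs_state _ _ _ _ S obs _ _ (fun=> 0) (fun=> 0)) => // i iN.
rewrite -st 1?ltnW // state0 !mulmx0 !addr0 -(gy i iN) comb_output ?gu //.
  by rewrite mulmx0 addr0.
exact: leq_trans nL.
Qed.

Hypothesis pe : persistently_exciting N (n.+1 + n) ud.

(** [H *m pinv H] fixes exactly the column space of [H], so the equation says that the constant
    sequence is a combination of data windows. The fundamental lemma provides the combination;
    conversely, every combination is a trajectory. *)
Lemma equilibrium_SuSy us ys :
  equilibrium S us ys <-> Su n N ud yd *m us + Sy n N ud yd *m ys = 0.
Proof.
rewrite -mul_row_col /Su /Sy hsubmxK /equil_mx -mulmxA.
rewrite mul_block_col !mul0mx addr0 add0r !mul_ones_tens !mul1mx.
set w := col_mx (ones_tens _ us) _; set H := Hequil n N ud yd.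
rewrite mulmxBl mul1mx; split=> [/(equilibriumP obs)[xs [ex ey]]|/eqP].
  have xdE k (kN : (k < N)%N) := (data_traj kN).1.
  have [g [g0 gu]] := fundamental_lemma ctrb xdE pe xs (fun=> us).
  suff -> : w = H *m g by rewrite mulmx_pinv_fix subrr.
  rewrite /w /H mul_col_mx; congr col_mx; apply: brow_inj => i iL.
    by rewrite brow_ones_tens // brow_hankel_mul // gu.
  rewrite brow_ones_tens // brow_hankel_mul // comb_output // gu //.
  rewrite (@comb_state _ g 0 i) // 1?ltnW // g0 (@eq_state _ _ _ _ _ _ _ (fun=> us)).
    by rewrite state_const.
  by move=> j ji; rewrite gu // (ltn_trans ji).
rewrite subr_eq0 -mulmxA => /eqP; rewrite {1}/H mul_col_mx.
set g := _ *m w => /eq_col_mx[eu ey].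
exists (comb xd g 0), (comb xd g); split=> // k kn.
have <- : comb ud g k = us by rewrite -(brow_hankel_mul _ _ kn) eu brow_ones_tens.
have <- : comb yd g k = ys by rewrite -(brow_hankel_mul _ _ kn) ey brow_ones_tens.
split; last exact: comb_output.
by have := @comb_state _ g k 1; rewrite addn1 => -> //=; rewrite addn0.
Qed.

End DataTrajectories.

(** * The closed loop *)

Section ClosedLoop.
Variables (R : realType) (n m p N mu mustar q : nat) (S : lti R n m p).
Variables (ud : nat -> 'cV[R]_m) (yd : nat -> 'cV[R]_p) (xd : nat -> 'cV[R]_n).
Variable Q : 'M[R]_(q, ncols N (2 * n + mu).+1).
Variables (gu gy : R) (fu : nat -> 'cV[R]_m -> R) (fy : nat -> 'cV[R]_p -> R).
Variables (v0 : 'cV[R]_m) (uhat0 : 'cV[R]_((mu + 1) * m)).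
Variable I : iterates R m p mu (ncols N (2 * n + mu).+1).
Variables (u : int -> 'cV[R]_m) (y : int -> 'cV[R]_p) (x : int -> 'cV[R]_n).
Hypotheses (ctrb : controllable S) (obs : observable S).
Hypothesis data_traj : forall k, (k < N)%N -> sys_eq S (xd k) (xd k.+1) (ud k) (yd k).
Hypothesis alg : algorithm ud yd Q gu gy fu fy v0 uhat0 I u y.
Hypothesis sysx : forall k : int, - n%:Z <= k -> sys_eq S (x k) (x (k + 1)) (u k) (y k).
Hypothesis ass1 : forall y', exists u', equilibrium S u' y'.
Hypothesis pe : persistently_exciting N (3 * n + mu + 1) ud.
Hypothesis mustarP : is_ctrb_index S mustar.
Hypothesis mustar_le : (mustar <= mu)%N.

Local Notation A := (sysA S).
Local Notation B := (sysB S).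
Local Notation C := (sysC S).
Local Notation D := (sysD S).
Local Notation v := (it_v I).
Local Notation us := (it_us I).
Local Notation uhat := (it_uhat I).
Local Notation ys := (it_ys I).
Local Notation yhat := (it_yhat I).
Local Notation omega := (it_omega I).
Local Notation alpha := (it_alpha I).
Local Notation beta := (it_beta I).
Local Notation SU := (Su n N ud yd).
Local Notation SY := (Sy n N ud yd).
Local Notation L1 := ((2 * n + mu).+1).

Lemma predS_int (t : nat) : t.+1%:Z - 1 = t%:Z.
Proof. by rewrite intS addrAC subrr add0r. Qed.

Let pe_equil : persistently_exciting N (n.+1 + n) ud.
Proof. by apply: persistently_exciting_le pe; lia. Qed.

Let pe_pred : persistently_exciting N (L1 + n) ud.
Proof. by apply: persistently_exciting_le pe; lia. Qed.

Let equilSuSy := equilibrium_SuSy data_traj obs ctrb pe_equil.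

(** [us t] is the projection of [v t] onto the inputs that are in equilibrium with [ys t];
    Assumption 1 puts [SY *m ys t] into the range of [SU]. *)
Lemma us_equilibrium (t : nat) : equilibrium S (us t) (ys t).
Proof.
apply/equilSuSy; have [u' /equilSuSy] := ass1 (ys t).
move=> /eqP; rewrite addrC addr_eq0 => /eqP SYy.
rewrite (alg_us alg) mulmxBr !mulmxA mulmxBr mulmx1 !mulmxA.
case: (pinvP SU) => -> _ _ _; rewrite subrr mul0mx sub0r.
rewrite -!mulmxA SYy !mulmxN opprK !mulmxA.
by case: (pinvP SU) => -> _ _ _; rewrite subrr.
Qed.

(** Subtracting the equation of the equilibrium [(eta, theta)] makes this difference linear in the
    tracking errors. *)
Lemma us_sub_v (t : nat) (eta : 'cV[R]_m) (theta : 'cV[R]_p) :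
  equilibrium S eta theta ->
  us t - v t = - (Defs.pinv SU *m (SU *m (v t - eta) + SY *m (ys t - theta))).
Proof.
move=> /equilSuSy e; rewrite (alg_us alg).
have -> : SU *m (v t - eta) + SY *m (ys t - theta) = SU *m v t + SY *m ys t.
  by rewrite !mulmxBr addrACA -opprD e subr0.
by rewrite mulmxBl mul1mx mulmxDr !mulmxA opprD addrAC [_ - _ - v t]addrAC subrr add0r.
Qed.

(** In all windows, indices below [n] are the past, index [n] is the current time and index [n + mu]
    begins the terminal phase. *)
Lemma omega_blocks (t : nat) :
  [/\ forall i, (i < n)%N -> comb ud (omega t) i = 0,
      forall i, (i < mu + n.+1)%N -> comb ud (omega t) (n + i) = v t &
      forall i, (i < n)%N -> comb yd (omega t) i = 0].
Proof.
have := alg_omega alg t; rewrite /Halpha !mul_col_mx /rhs_omega.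
move=> /eq_col_mx[/eq_col_mx[e1 e2] e3]; split=> i iN.
- have := congr1 (brow i) e1; rewrite brow0 => <-.
  by rewrite brow_brows_hankel_mul //; lia.
- have := congr1 (brow i) e2; rewrite brow_ones_tens // => <-.
  by rewrite brow_brows_hankel_mul //; lia.
- have := congr1 (brow i) e3; rewrite brow0 => <-.
  by rewrite brow_brows_hankel_mul //; lia.
Qed.

Lemma alpha_blocks (t : nat) :
  [/\ forall i, (i < n)%N -> comb ud (alpha t) i = u (t%:Z - n%:Z + i%:Z),
      forall i, (i < mu)%N -> comb ud (alpha t) (n + i) = brow i.+1 (uhat (t%:Z - 1)),
      forall i, (i <= n)%N -> comb ud (alpha t) (n + (mu + i)) =
                              us (t%:Z - 1) - v (t%:Z - 1) &
      forall i, (i < n)%N -> comb yd (alpha t) i = y (t%:Z - n%:Z + i%:Z)].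
Proof.
have := alg_alpha alg t; rewrite /Halpha !mul_col_mx /rhs_alpha.
move=> /eq_col_mx[/eq_col_mx[e1 e2] e3]; split=> i iN.
- have := congr1 (brow i) e1; rewrite brow_window // => <-.
  by rewrite brow_brows_hankel_mul //; lia.
- have := congr1 (brow i) e2; rewrite brow_bcatl // brow_brows // add1n => <-.
  by rewrite brow_brows_hankel_mul //; lia.
- have := congr1 (brow (mu + i)) e2; rewrite brow_bcatr // brow_ones_tens // => <-.
  by rewrite brow_brows_hankel_mul //; lia.
- have := congr1 (brow i) e3; rewrite brow_window // => <-.
  by rewrite brow_brows_hankel_mul //; lia.
Qed.

Lemma omega_state (t : nat) : comb xd (omega t) n = 0.
Proof.
have [wu _ wy] := omega_blocks t.
by apply: (comb_state_eq0 data_traj) => //; lia.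
Qed.

(** The [n] past inputs and outputs agree with the closed loop, so observability identifies the
    state at time [t - n], and the inputs carry it to time [t]. *)
Lemma alpha_state (t : nat) : comb xd (alpha t) n = x t.
Proof.
have [a1 _ _ a4] := alpha_blocks t.
pose x' i := x (t%:Z - n%:Z + i%:Z); pose u' i := u (t%:Z - n%:Z + i%:Z).
have sys' i : sys_eq S (x' i) (x' i.+1) (u' i) (y (t%:Z - n%:Z + i%:Z)).
  have -> : x' i.+1 = x (t%:Z - n%:Z + i%:Z + 1).
    by rewrite /x'; congr x; lia.
  by apply: sysx; lia.
have stx i : x' i = state S (x' 0%N) u' i.
  by apply: (@state_unique _ _ _ _ S x' u' i) => // k _; case: (sys' k).
have st i : (i <= n)%N -> comb xd (alpha t) i = state S (comb xd (alpha t) 0) u' i.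
  move=> iN; rewrite (@comb_state _ _ _ _ _ S ud yd xd data_traj L1 _ 0 i);
    last by lia.
  by apply: eq_state => j ji; rewrite a1 // (leq_trans ji).
rewrite st // (_ : comb xd (alpha t) 0 = x' 0%N).
  by rewrite -stx /x' subrK.
apply: (@obs_state _ _ _ _ S obs _ _ u' u') => // i iN.
rewrite -st 1?ltnW // -stx; case: (sys' i) => _ <-; rewrite -a4 //.
by rewrite (comb_output data_traj) ?a1 //; lia.
Qed.

(* [free] is the prediction without, [pred] the one with the correction [beta]. *)
Let free t := alpha t + omega t.
Let pred t := alpha t + omega t + beta t.

Lemma free_state (t : nat) : comb xd (free t) n = x t.
Proof. by rewrite combD alpha_state omega_state addr0. Qed.

(** The constraint is feasible: the witness [g] starts at rest, steers in [mu] steps through the gap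
    between the equilibrium state and the uncorrected prediction, and then corrects the input to
    [us t]. *)
Lemma beta_solves (t : nat) :
  Hbeta n N mu ud yd *m beta t =
    rhs_beta (mu := mu) ud yd I t.
Proof.
have [xs [ex ey]] := (equilibriumP obs _ _).1 (us_equilibrium t).
have [w wE] := ctrb_index_reach (xs - comb xd (free t) (n + mu)) mustarP mustar_le.
pose b i := if (i < n)%N then 0 else if (i < n + mu)%N then w (i - n)%N
            else us t - comb ud (free t) i.
have xdE k (kN : (k < N)%N) := (data_traj kN).1.
have [g [g0 gb]] := fundamental_lemma ctrb xdE pe_pred 0 b.
have stn i : (i <= n)%N -> comb xd g i = 0.
  move=> iN; have -> := @comb_state _ _ _ _ _ S ud yd xd data_traj L1 g 0 i; last by lia.
  rewrite g0 (@eq_state _ _ _ _ _ _ _ (fun=> 0)) ?state0 // => j ji.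
  by rewrite gb /b; [rewrite ifT //; lia|lia].
have stmu : comb xd g (n + mu) = xs - comb xd (free t) (n + mu).
  rewrite (comb_state data_traj); last by lia.
  rewrite stn // -wE; apply: eq_state => j jmu.
  rewrite gb; last by lia.
  by rewrite /b ifN -?leqNgt ?leq_addr // ifT ?ltn_add2l // addKn.
have stout i : (i <= n)%N -> comb xd (g + free t) (n + mu + i) = xs.
  move=> iN; rewrite (comb_state data_traj); last by lia.
  rewrite combD stmu subrK (@eq_state _ _ _ _ _ _ _ (fun=> us t)).
    exact: state_const.
  move=> j ji; rewrite combD gb; last by lia.
  by rewrite /b !ifN ?subrK // -leqNgt; lia.
rewrite (alg_beta alg) (_ : rhs_beta _ _ _ _ = Hbeta n N mu ud yd *m g).
  exact: mulmx_weighted_sol.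
rewrite /rhs_beta /Hbeta !mul_col_mx; congr (col_mx (col_mx _ _) (col_mx _ _));
  apply: brow_inj => i iN.
- rewrite brow0 brow_brows_hankel_mul //; last by lia.
  by rewrite gb /b ?ifT //; lia.
- rewrite browD browN brow_ones_tens // !brow_brows_hankel_mul //; try by lia.
  by rewrite gb /b ?ifN // -?leqNgt; lia.
- rewrite brow0 brow_brows_hankel_mul //; last by lia.
  rewrite (comb_output data_traj) ?stn ?gb; [|lia|lia|lia].
  by rewrite /b ifT ?mulmx0 ?addr0.
- rewrite browD browN brow_ones_tens // !brow_brows_hankel_mul //; try by lia.
  rewrite -/(free t); apply/eqP; rewrite subr_eq -combD.
  rewrite (comb_output data_traj); last by lia.
  rewrite stout 1?ltnW // combD gb; last by lia.
  by rewrite /b !ifN ?subrK -?ey // -leqNgt; lia.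
Qed.

Lemma beta_blocks (t : nat) :
  [/\ forall i, (i < n)%N -> comb ud (beta t) i = 0,
      forall i, (i < n)%N -> comb yd (beta t) i = 0,
      forall i, (i <= n)%N -> comb ud (pred t) (n + mu + i) = us t &
      forall i, (i < n)%N -> comb yd (pred t) (n + mu + i) = ys t].
Proof.
have := beta_solves t; rewrite /Hbeta /rhs_beta !mul_col_mx.
move=> /eq_col_mx[/eq_col_mx[e1 e2] /eq_col_mx[e3 e4]]; split=> i iN.
- by rewrite -(@brow_brows_hankel_mul _ _ _ L1 _ _ 0 n) ?e1 ?brow0 //; lia.
- by rewrite -(@brow_brows_hankel_mul _ _ _ L1 _ _ 0 n) ?e3 ?brow0 //; lia.
- rewrite combD -(@brow_brows_hankel_mul _ _ _ L1 _ (beta t) (n + mu) n.+1) //;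
    last by lia.
  rewrite e2.
  rewrite browD browN brow_ones_tens // brow_brows_hankel_mul //; last by lia.
  by rewrite addrC subrK.
- rewrite combD -(@brow_brows_hankel_mul _ _ _ L1 _ (beta t) (n + mu) n) //;
    last by lia.
  rewrite e4.
  rewrite browD browN brow_ones_tens // brow_brows_hankel_mul //; last by lia.
  by rewrite addrC subrK.
Qed.

Lemma beta_state (t : nat) : comb xd (beta t) n = 0.
Proof.
have [bu by_ _ _] := beta_blocks t.
by apply: (comb_state_eq0 data_traj) => //; lia.
Qed.

Lemma pred_state (t : nat) : comb xd (pred t) n = x t.
Proof. by rewrite combD free_state beta_state addr0. Qed.

Lemma pred_input (t : nat) i : (i <= mu)%N ->
  comb ud (pred t) (n + i) = brow i (uhat t) + v t.
Proof.
have [_ a2 a3 _] := alpha_blocks t; have [_ wn _] := omega_blocks t.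
move=> imu; rewrite /pred !combD wn; last by lia.
rewrite (alg_uhat alg) browD brow_brows_hankel_mul; [|by lia|by lia].
(* The last block is the appended [us - v] of time [t - 1]; the earlier ones come from the shifted
   plan. *)
rewrite addrAC; congr (_ + _ + _); move: imu; rewrite leq_eqVlt => /predU1P[->|imu].
  have := a3 0%N isT; have := @brow_bcatr R m 1 mu 1 0.
  by rewrite !addn0 => -> // ->; rewrite brow_ones_tens.
by rewrite a2 // brow_bcatl // brow_brows // add1n.
Qed.

(** During [n] terminal steps inputs and outputs are those of the equilibrium, so by observability
    the state is too, and it stays there until the end of the window. *)
Lemma pred_end_state (t : nat) i : (i <= n.+1)%N ->
  is_equil S (us t) (ys t) (comb xd (pred t) (n + mu + i)).
Proof.
have [_ _ pu py] := beta_blocks t.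
have [xs [ex ey]] := (equilibriumP obs _ _).1 (us_equilibrium t).
have st j : (j <= n.+1)%N -> comb xd (pred t) (n + mu + j) =
    state S (comb xd (pred t) (n + mu)) (fun=> us t) j.
  move=> jn; rewrite (comb_state data_traj); last by lia.
  by apply: eq_state => k kj; rewrite pu //; lia.
suff e0 : comb xd (pred t) (n + mu) = xs.
  by move=> iN; rewrite st // e0 state_const.
apply: (@obs_state _ _ _ _ S obs _ _ (fun=> us t) (fun=> us t)) => // j jn.
rewrite -st; last by lia.
rewrite state_const // -ey -(py j jn) (comb_output data_traj) ?pu //; lia.
Qed.

(** The constraint fixes the outputs for [i < n]; the equilibrium state adds [i = n]. *)
Lemma pred_end_output (t : nat) i : (i <= n)%N ->
  comb yd (pred t) (n + mu + i) = ys t.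
Proof.
move=> iN; have [_ _ pu _] := beta_blocks t; rewrite (comb_output data_traj); last by lia.
by have [_ ->] := @pred_end_state t i (leqW iN); rewrite pu.
Qed.

Lemma pred_now (t : nat) : comb ud (pred t) n = u t /\ comb yd (pred t) n = y t.
Proof.
have eu : comb ud (pred t) n = u t.
  by have := @pred_input t 0 isT; rewrite addn0 (alg_u alg).
split=> //; rewrite (comb_output data_traj); last by lia.
by rewrite eu pred_state; have [|_ <-] // := @sysx t; lia.
Qed.

Lemma pred_next_state (t : nat) : comb xd (pred t) n.+1 = x t.+1.
Proof.
have -> : x t.+1 = x (t%:Z + 1) by congr x; lia.
have [|-> _] := @sysx t; first by lia.
rewrite -[n.+1]addn1 (comb_state data_traj) /= ?addn0; last by lia.
by rewrite pred_state (pred_now t).1.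
Qed.

(** * Comparison of successive predictions *)

Section Next.
Variable t : nat.
Let dv := v t.+1 - v t.

(** Plans are stored relative to [v t] and read relative to [v t.+1], which shifts all inputs by
    [dv]. *)
Lemma free_next_input i : (i < mu + n)%N ->
  comb ud (free t.+1) (n + i) = comb ud (pred t) (n + i.+1) + dv.
Proof.
have [_ a2 a3 _] := alpha_blocks t.+1; have [_ wn _] := omega_blocks t.+1.
have [_ _ pu _] := beta_blocks t.
move=> iN; rewrite combD wn; last by lia.
have [imu|mui] := ltnP i mu.
  by rewrite a2 // pred_input // predS_int -addrA [v t + _]addrC subrK.
rewrite -(subnKC mui) a3; last by lia.
have -> : (n + (mu + (i - mu)).+1 = n + mu + (i - mu).+1)%N by lia.
rewrite pu; last by lia.
by rewrite predS_int -addrA /dv [- _ + _]addrC.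
Qed.

(** This includes the last index [2 * n + mu], whose counterpart in [pred t] lies beyond the
    window. *)
Lemma free_next_end_input i : (i <= n)%N ->
  comb ud (free t.+1) (n + mu + i) = us t + dv.
Proof.
have [_ _ a3 _] := alpha_blocks t.+1; have [_ wn _] := omega_blocks t.+1.
move=> iN; rewrite combD -addnA wn ?a3 //; last by lia.
by rewrite predS_int -addrA /dv [- _ + _]addrC.
Qed.

(** Superposition: both trajectories start in [x t.+1], and their inputs differ by the constant
    [dv]. *)
Lemma free_next_state k : (k <= mu + n)%N ->
  comb xd (free t.+1) (n + k) = comb xd (pred t) (n + k.+1) + step_gain S k *m dv.
Proof.
move=> kN; rewrite (comb_state data_traj); last by lia.
rewrite free_state -pred_next_state -state_step.
have -> : (n + k.+1 = n.+1 + k)%N by lia.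
rewrite -[comb xd _ n.+1]addr0.
rewrite (@comb_state _ _ _ _ _ S ud yd xd data_traj L1 (pred t) n.+1 k);
  last by lia.
rewrite -stateD; apply: eq_state => j jk.
by rewrite free_next_input ?addSnnS //; lia.
Qed.

Lemma free_next_output k : (k < mu + n)%N ->
  comb yd (free t.+1) (n + k) =
  comb yd (pred t) (n + k.+1) + (C *m step_gain S k + D) *m dv.
Proof.
move=> kN; rewrite !(comb_output data_traj); [|by lia|by lia].
rewrite free_next_state 1?ltnW // free_next_input //.
rewrite (mulmxDr C) (mulmxDr D) mulmxDl mulmxA.
by rewrite addrACA.
Qed.

Lemma free_next_end_output i : (i <= n)%N ->
  comb yd (free t.+1) (n + mu + i) = ys t + (C *m step_gain S (mu + i) + D) *m dv.
Proof.
move=> iN; rewrite (comb_output data_traj); last by lia.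
rewrite free_next_end_input // -addnA free_next_state; last by lia.
have -> : (n + (mu + i).+1 = n + mu + i.+1)%N by lia.
have [_ ->] := @pred_end_state t i.+1 iN.
by rewrite (mulmxDr C) (mulmxDr D) mulmxDl mulmxA addrACA.
Qed.

Lemma yhat_next : yhat t.+1 = ys t + (C *m step_gain S mu + D) *m dv.
Proof.
rewrite (alg_yhat alg) -brow_mul brow_hankel_mul; last by lia.
by have := @free_next_end_output 0 isT; rewrite !addn0.
Qed.

End Next.

Let end_index i : (i <= n)%N -> (n + mu + i < L1)%N.
Proof. by lia. Qed.

Let early_index j : (j < mu)%N -> (j < mu + n)%N.
Proof. by lia. Qed.

(** * Tracking of the minimizers *)

Section Tracking.
Variables (au lu ay ly : R) (eta : int -> 'cV[R]_m) (theta : int -> 'cV[R]_p).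
Hypothesis eta_min : forall t : nat, is_argmin (fu t) (eta t).
Hypothesis theta_min : forall t : nat, is_argmin (fy t) (theta t).
Hypotheses (au_gt0 : 0 < au) (ay_gt0 : 0 < ay).
Hypothesis fu_cvx : forall t : nat, strongly_convex au (fu t) /\ smooth lu (fu t).
Hypothesis fy_cvx : forall t : nat, strongly_convex ay (fy t) /\ smooth ly (fy t).
Hypothesis gu_step : 0 < gu <= 2 / (lu + au).
Hypothesis gy_step : 0 < gy <= 2 / (ly + ay).
Hypothesis eta_equil : forall t : nat, equilibrium S (eta t) (theta t).

Definition path_increment (t : nat) : R :=
  enorm (eta t%:Z - eta (t%:Z - 1)) + enorm (theta t%:Z - theta (t%:Z - 1)).

Local Notation pb := (path_bounded path_increment).
Local Notation pbv := (path_bounded_vec path_increment).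

Let inc_ge0 (t : nat) : 0 <= path_increment t.
Proof. by rewrite addr_ge0 ?enorm_ge0. Qed.

Let eta_inc : pbv (fun t => eta t%:Z - eta (t%:Z - 1)).
Proof.
by apply: path_bounded_le (path_bounded_id _) => t; rewrite lerDl enorm_ge0.
Qed.

Let theta_inc : pbv (fun t => theta t%:Z - theta (t%:Z - 1)).
Proof.
by apply: path_bounded_le (path_bounded_id _) => t; rewrite lerDr enorm_ge0.
Qed.

Let rate_lt1 (g a : R) : 0 < g -> 0 < a -> 0 <= Num.max 0 (1 - g * a) < 1.
Proof. by move=> g0 a0; rewrite le_max lexx /= gt_max ltr01 gtrBl mulr_gt0. Qed.

Lemma v_contraction (t : nat) :
  enorm (v t.+1 - eta t) <= Num.max 0 (1 - gu * au) * enorm (v t - eta t).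
Proof.
have [sc sm] := fu_cvx t; rewrite (alg_v alg).
exact: (gradient_step (l := lu)).
Qed.

Lemma ys_contraction (t : nat) :
  enorm (ys t.+1 - theta t) <= Num.max 0 (1 - gy * ay) * enorm (yhat t.+1 - theta t).
Proof.
have [sc sm] := fy_cvx t; rewrite (alg_ys alg).
exact: (gradient_step (l := ly)).
Qed.

Let rate_u := rate_lt1 (andP gu_step).1 au_gt0.
Let rate_y := rate_lt1 (andP gy_step).1 ay_gt0.

(** A contraction towards [eta t], followed by the drift to [eta t.+1]. *)
Lemma v_tracks : pbv (fun t => v t - eta t).
Proof.
apply: (path_bounded_contraction rate_u _ _ _ _ (path_bounded0 _) eta_inc)
  => t; rewrite ?enorm_ge0 //.
apply: le_trans (enorm_triangle (eta t) _ _) _; rewrite addr0 predS_int.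
by rewrite (enormB (eta t)) lerD2r v_contraction.
Qed.

Lemma v_inc : pbv (fun t => v t.+1 - v t).
Proof.
apply: path_bounded_le (path_boundedD v_tracks v_tracks) => t.
apply: le_trans (enorm_triangle (eta t) _ _) _; rewrite (enormB (eta t)) lerD2r.
apply: le_trans (v_contraction t) _; rewrite ler_piMl ?enorm_ge0 //.
by case/andP: rate_u => _ /ltW.
Qed.

Let yhat_dev : pbv (fun t => yhat t.+1 - ys t).
Proof.
apply: path_bounded_vec_ext (path_bounded_vecM _ v_inc) => t.
by rewrite yhat_next addrAC subrr add0r.
Qed.

(** The gradient step starts at [yhat t.+1], which replaces [ys t] up to the prediction error. *)
Let ys_step (t : nat) : enorm (ys t.+1 - theta t) <=
  Num.max 0 (1 - gy * ay) * enorm (ys t - theta t) + enorm (yhat t.+1 - ys t).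
Proof.
have /andP[k0 k1] := rate_y; apply: le_trans (ys_contraction t) _.
apply: le_trans (ler_wpM2l k0 (enorm_triangle (ys t) _ _)) _.
by rewrite mulrDr addrC lerD2l ler_piMl ?enorm_ge0 // ltW.
Qed.

Lemma ys_tracks : pbv (fun t => ys t - theta t).
Proof.
apply: (path_bounded_contraction rate_y _ _ _ _ yhat_dev theta_inc)
  => t; rewrite ?enorm_ge0 //.
apply: le_trans (enorm_triangle (theta t) _ _) _; rewrite predS_int.
by rewrite (enormB (theta t)) lerD2r ys_step.
Qed.

Lemma ys_inc : pbv (fun t => ys t.+1 - ys t).
Proof.
apply: path_bounded_le
  (path_boundedD (path_boundedD ys_tracks yhat_dev) ys_tracks) => t.
apply: le_trans (enorm_triangle (theta t) _ _) _; rewrite (enormB (theta t)) lerD2r.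
apply: le_trans (ys_step t) _; rewrite lerD2r ler_piMl ?enorm_ge0 //.
by case/andP: rate_y => _ /ltW.
Qed.

Lemma us_inc : pbv (fun t => us t.+1 - us t).
Proof.
apply: path_bounded_vec_ext (path_bounded_vecB
  (path_bounded_vecM (1%:M - Defs.pinv SU *m SU) v_inc)
  (path_bounded_vecM (Defs.pinv SU *m SY) ys_inc)) => t.
rewrite !(alg_us alg) !mulmxBr !opprB addrACA [RHS]addrACA.
by rewrite [X in _ = _ + X]addrC.
Qed.

Lemma us_v_dev : pbv (fun t => us t - v t).
Proof.
apply: path_bounded_vec_ext (path_bounded_vecN (path_bounded_vecM (Defs.pinv SU)
  (path_bounded_vecD (path_bounded_vecM SU v_tracks)
                     (path_bounded_vecM SY ys_tracks)))) => t.
by rewrite (us_sub_v t (eta_equil t)).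
Qed.

Let beta_succ_pb : pbv (fun t => beta t.+1).
Proof.
(* [G] stacks the responses to a constant input in the terminal phase, and [W] is the matrix of the
   weighted pseudoinverse formula. Time 0 is left out because it has no preceding prediction. *)
pose G : 'M[R]_(n * p, m) := blockcol n (fun i => C *m step_gain S (mu + i) + D).
pose W := (1%:M - Defs.pinv (Q *m (1%:M - Defs.pinv (Hbeta n N mu ud yd) *m
  Hbeta n N mu ud yd)) *m Q) *m Defs.pinv (Hbeta n N mu ud yd).
apply: path_bounded_vec_ext (path_bounded_vecM W (path_bounded_vec_col_mx
  (path_bounded_vec_col_mx (path_bounded_vec0 _ (n * m))
     (path_bounded_vecM (ones_tens n.+1 1%:M) (path_bounded_vecB us_inc v_inc)))
  (path_bounded_vec_col_mx (path_bounded_vec0 _ (n * p))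
     (path_bounded_vecB (path_bounded_vecM (ones_tens n 1%:M) ys_inc)
                        (path_bounded_vecM G v_inc))))) => t.
rewrite (alg_beta alg) /weighted_sol -/W mulmxA; congr (W *m _).
rewrite /rhs_beta; congr (col_mx (col_mx _ _) (col_mx _ _)); apply: brow_inj => i iN.
  rewrite mul_ones_tens mul1mx browD browN !brow_ones_tens //.
  rewrite (@brow_brows_hankel_mul _ _ _ L1 ud (free t.+1)) //; last exact: end_index.
  by rewrite free_next_end_input //; apply/colP => r; rewrite !mxE; ring.
rewrite mul_ones_tens mul1mx browD [in RHS]browD !browN !brow_ones_tens //.
rewrite (@brow_brows_hankel_mul _ _ _ L1 yd (free t.+1)) //;
  last exact: end_index (ltnW iN).
rewrite free_next_end_output 1?ltnW // brow_mul brow_blockcol //.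
set dy := _ *m _; apply/colP => r; rewrite [LHS]mxE [RHS]mxE !mxE; ring.
Qed.

Let beta_comb k (z : nat -> 'cV[R]_k) i : pbv (fun t => comb z (beta t.+1) i).
Proof.
pose Z : 'M[R]_(k, ncols N L1) := \matrix_(r, j) z (i + j)%N r 0.
apply: path_bounded_vec_ext (path_bounded_vecM Z beta_succ_pb) => t.
apply/colP => r; rewrite mxE summxE; apply: eq_bigr => j _.
by rewrite !mxE mulrC.
Qed.

(** Split the error at [us t] and [v t]; the part [u t - us t] telescopes along the horizon. *)
Lemma u_tracks : pbv (fun t => u t - eta t).
Proof.
have tel : pbv (fun t => comb ud (pred t) (n + 0) - us t).
  apply: (path_bounded_telescope inc_ge0 (mu := mu)
    (w := fun t j => comb ud (pred t) (n + j))
    (e := fun j t => v t.+1 - v t + comb ud (beta t.+1) (n + j))).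
  - by move=> t; have [_ _ + _] := beta_blocks t; move=> /(_ 0%N isT); rewrite addn0.
  - move=> t j jmu; rewrite combD free_next_input ?addrA //; exact: early_index.
  - by move=> j; apply: path_bounded_vecD v_inc (beta_comb _ _).
  - exact: us_inc.
apply: path_bounded_vec_ext
  (path_bounded_vecD (path_bounded_vecD tel us_v_dev) v_tracks) => t.
by rewrite addn0 (pred_now t).1 !addrA !subrK.
Qed.

Lemma y_tracks : pbv (fun t => y t - theta t).
Proof.
have tel : pbv (fun t => comb yd (pred t) (n + 0) - ys t).
  apply: (path_bounded_telescope inc_ge0 (mu := mu)
    (w := fun t j => comb yd (pred t) (n + j))
    (e := fun j t => (C *m step_gain S j + D) *m (v t.+1 - v t) +
                     comb yd (beta t.+1) (n + j))).
  - by move=> t; have := @pred_end_output t 0 isT; rewrite addn0.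
  - move=> t j jmu; rewrite combD free_next_output ?addrA //; exact: early_index.
  - by move=> j; apply: path_bounded_vecD (path_bounded_vecM _ v_inc) (beta_comb _ _).
  - exact: ys_inc.
apply: path_bounded_vec_ext (path_bounded_vecD tel ys_tracks) => t.
by rewrite addn0 (pred_now t).2 addrA subrK.
Qed.

End Tracking.
End ClosedLoop.

(** * From tracking errors to regret *)

Lemma lipschitz_path_bounded (R : realType) k (r : nat -> R)
    (f : nat -> 'cV[R]_k -> R) (z e : int -> 'cV[R]_k) :
  lipschitz_on_bounded f z e ->
  path_bounded_vec r (fun t : nat => z t - e t) ->
  path_bounded r (fun t : nat => f t (z t) - f t (e t)).
Proof.
move=> [X [K [_ zX lip]]] zb.
apply: path_bounded_le (path_boundedZ (normr_ge0 K) zb) => t.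
have [zt et] := zX t; apply: le_trans (ler_norm _) _.
apply: le_trans (lip t _ _ zt et) _.
by rewrite ler_wpM2r ?enorm_ge0 ?ler_norm.
Qed.

Theorem theorem2 (R : realType) (n m p N mu mustar q : nat)
    (S : lti R n m p) (x0 : 'cV[R]_n)
    (ud : nat -> 'cV[R]_m) (yd : nat -> 'cV[R]_p)
    (Q : 'M[R]_(q, ncols N (2 * n + mu).+1))
    (L : nat -> 'cV[R]_m -> 'cV[R]_p -> R)
    (fu : nat -> 'cV[R]_m -> R) (fy : nat -> 'cV[R]_p -> R)
    (au lu ay ly gu gy : R)
    (v0 : 'cV[R]_m) (uhat0 : 'cV[R]_((mu + 1) * m))
    (I : iterates R m p mu (ncols N (2 * n + mu).+1))
    (u eta : int -> 'cV[R]_m) (y theta : int -> 'cV[R]_p) :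
  (* system and data *)
  controllable S -> observable S ->
  is_traj S N ud yd ->
  (* minimizers and their values at time -1 *)
  (forall t : nat, is_argmin (fu t) (eta t)) ->
  (forall t : nat, is_argmin (fy t) (theta t)) ->
  eta (- 1) = it_v I (- 1) -> theta (- 1) = it_yhat I 0%N ->
  (* closed loop *)
  algorithm ud yd Q gu gy fu fy v0 uhat0 I u y ->
  system_response S x0 u y ->
  (* Assumption 1 *)
  (forall y', exists u', equilibrium S u' y') ->
  (* Assumption 2 *)
  (forall (t : nat) u' y', L t u' y' = fu t u' + fy t y') ->
  0 < au -> 0 < ay ->
  (forall t : nat, strongly_convex au (fu t) /\ smooth lu (fu t)) ->
  (forall t : nat, strongly_convex ay (fy t) /\ smooth ly (fy t)) ->
  lipschitz_on_bounded fu u eta ->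
  lipschitz_on_bounded fy y theta ->
  (* Assumption 3 *)
  (forall t : nat, equilibrium S (eta t) (theta t)) ->
  (* Assumption 4 *)
  persistently_exciting N (3 * n + mu + 1) ud ->
  (* Assumption 5 *)
  is_ctrb_index S mustar -> (mustar <= mu)%N ->
  (* step sizes *)
  0 < gu <= 2 / (lu + au) ->
  0 < gy <= 2 / (ly + ay) ->
  exists Cmu Cu Cy : R,
    forall (T : nat) (ustar : nat -> 'cV[R]_m) (ystar : nat -> 'cV[R]_p),
      hindsight_optimal S x0 L T ustar ystar ->
      \sum_(0 <= t < T.+1) (L t (u t) (y t) - L t (ustar t) (ystar t)) <=
        Cmu + Cu * (\sum_(0 <= t < T.+1) enorm (eta t%:Z - eta (t%:Z - 1)))
            + Cy * (\sum_(0 <= t < T.+1) enorm (theta t%:Z - theta (t%:Z - 1))).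
Proof.
move=> ctrb obs [xd0 [xd [_ data]]] eta_min theta_min _ _ alg [x [_ sysx]] ass1 LE
  au0 ay0 fu_cvx fy_cvx lip_u lip_y equil pe mustarP mustar_le gu_step gy_step.
have ub := u_tracks ctrb obs data alg sysx ass1 pe mustarP mustar_le
  eta_min theta_min au0 ay0 fu_cvx fy_cvx gu_step gy_step equil.
have yb := y_tracks ctrb obs data alg sysx ass1 pe mustarP mustar_le
  eta_min theta_min au0 ay0 fu_cvx fy_cvx gu_step gy_step.
have [c [K [K0 h]]] := path_boundedD (lipschitz_path_bounded lip_u ub)
                                     (lipschitz_path_bounded lip_y yb).
(* [path_increment] adds both increments, so one factor serves both path lengths. *)
exists c, K, K => T ustar ystar _.
have := h T.+1; rewrite [X in K * X]big_split /= mulrDr addrA.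
apply: le_trans; apply: ler_sum => t _; rewrite !LE.
have := eta_min t (ustar t); have := theta_min t (ystar t); lra.
Qed.
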